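(* Let $\mathcal M=\tilde{\mathcal M}/\mathbb C^\times$ be a projective special Kähler manifold as described in the context, and let $\tilde\Xi$ be the holomorphic cubic form of the rigid special Kähler manifold $\tilde{\mathcal M}$. For vector fields $X,Y,Z$ of type $(1,0)$ on $\mathcal M$ with horizontal lifts $\tilde X,\tilde Y,\tilde Z$ to $\tilde{\mathcal M}$, put $$\Xi(X,Y,Z)=\tilde\Xi(\tilde X,\tilde Y,\tilde Z).$$ Then $\tilde\Xi$ descends in this way to a section $\Xi$ over $\mathcal M$ of $(L^* )^{\otimes2}\otimes(T^*\mathcal M)^{\otimes3}$; that is, the function $f=\tilde\Xi(\tilde X,\tilde Y,\tilde Z)$ on $\tilde{\mathcal M}$ satisfies $f(\mathfrak R_b(x))=b^2f(x)$ for all $b\in\mathbb C^\times$, and $\Xi$ is tensorial in $X,Y,Z$.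
   Context: Rigid special (pseudo-)Kähler manifold: a (pseudo-)Kähler manifold $\tilde{\mathcal M}$ with metric $\tilde g$ of arbitrary signature, complex structure $\tilde J$, Kähler form $\tilde\Phi(X,Y)=\tilde g(X,\tilde JY)$, together with a real, flat, torsion-free connection $\tilde\nabla$ with $\tilde\nabla\tilde\Phi=0$ and $d_{\tilde\nabla}\tilde J=0$ ($\tilde J$ viewed as a $T\tilde{\mathcal M}$-valued 1-form, $d_{\tilde\nabla}$ the covariant exterior differential). Its holomorphic cubic form is $\tilde\Xi(X,Y,Z)=2\,\frac{\partial^3\mathcal F}{\partial\eta^\alpha\partial\eta^\beta\partial\eta^\gamma}X^\alpha Y^\beta Z^\gamma$ in special coordinates $\eta^\alpha$ with prepotential $\mathcal F$; globally, $\tilde\Xi(X,Y,Z)=\tilde\Phi(\pi^{(1,0)}X,(\tilde\nabla_Y\pi^{(1,0)})Z)$ with $\pi^{(1,0)}$ the projection of the complexified tangent bundle onto $T^{1,0}$. (Special coordinates are local holomorphic coordinates for which $\mathrm{Re}\,\eta^\alpha$, $8\,\mathrm{Re}(\partial\mathcal F/\partial\eta^\alpha)$ are $\tilde\nabla$-flat Darboux coordinates and $\tilde g(\partial_{\eta^\alpha},\partial_{\bar\eta^\beta})=2\,\mathrm{Im}\,\frac{\partial^2\mathcal F}{\partial\eta^\alpha\partial\eta^\beta}$.) Projective special Kähler manifold: $\mathcal M=\tilde{\mathcal M}/\mathbb C^\times$, where $\tilde{\mathcal M}$ is rigid special (pseudo-)Kähler with a free holomorphic action $\mathfrak R$ of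 $\mathbb C^\times$ making $\pi:\tilde{\mathcal M}\to\mathcal M$ a holomorphic principal bundle, whose fundamental $(1,0)$ vector field $H$, normalized by $(Hf)(x)=c\frac{d}{db}|_{b=1}f(\mathfrak R_b(x))$ for holomorphic $f$ ($c$ a nonzero real constant), satisfies $\tilde\nabla_YH=cY$ for all $Y\in T^{1,0}\tilde{\mathcal M}$ and $\tilde g(H,\bar H)\ne0$ everywhere. In special coordinates (shifted by constants) $H=c\,\eta^\alpha\partial_\alpha$ and $\mathfrak R_b(\eta)=b\eta$. $L$ is the line bundle over $\mathcal M$ of classes of vertical vectors $(x,\lambda H(x))$ under $(x,v)\sim(\mathfrak R_b(x),b^{-1}d\mathfrak R_bv)$; thus $(x,\lambda H(x))\sim(\mathfrak R_b(x),b^{-1}\lambda H(\mathfrak R_b(x)))$, and sections of $(L^* )^{\otimes k}$ correspond to functions $f$ on $\tilde{\mathcal M}$ with $f(\mathfrak R_b(x))=b^kf(x)$. Horizontal lifts are taken with respect to the connection on the principal bundle $\tilde{\mathcal M}$ with 1-form $\omega=y^{-1}dy+\partial_{z^i}\log|\mathcal K|\,dz^i$ in coordinates $(y,z^i)$ with $\mathfrak R_b(y,z)=(by,z)$, where $\mathcal K=\frac1{c^2}\tilde g(H,\bar H)$: $\tilde X$ is the unique $(1,0)$ vector field with $d\pi(\tilde X)=X$ and $\omega(\tilde X)=0$. *)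

(* Defs.v *)
From HB Require Import structures.
From mathcomp Require Import all_boot all_order all_algebra complex.
From mathcomp Require Import all_classical all_reals all_analysis.

Set Implicit Arguments.
Unset Strict Implicit.
Unset Printing Implicit Defensive.

Import Order.TTheory GRing.Theory Num.Theory.
Import numFieldNormedType.Exports.

Local Open Scope classical_set_scope.
Local Open Scope ring_scope.

(* C^n as a real normed space: (x, y) stands for the point z = x + i y. *)
Definition cspace (R : realType) (n : nat) : normedModType R :=
  ('rV[R]_n * 'rV[R]_n)%type.

Section Calculus.
Variables (R : realType) (n : nat).
Local Notation C := R[i].
Local Notation E := (cspace R n).
Implicit Types (f : E -> C) (p v : E) (j : 'I_n).

Definition zc p j : C := (p.1 ord0 j +i* p.2 ord0 j)%C.

Definition repart f : E -> R := fun p => complex.Re (f p).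
Definition impart f : E -> R := fun p => complex.Im (f p).

Definition dder v f : E -> C :=
  fun p => ('D_v (repart f) p +i* 'D_v (impart f) p)%C.

Definition ex j : E := (delta_mx ord0 j, 0).
Definition ey j : E := (0, delta_mx ord0 j).

(* Wirtinger derivatives d/dz^j and d/d(conj z^j) *)
Definition dz j f : E -> C :=
  fun p => (dder (ex j) f p - 'i%C * dder (ey j) f p) / 2%:R.
Definition dzb j f : E -> C :=
  fun p => (dder (ex j) f p + 'i%C * dder (ey j) f p) / 2%:R.

(* f is C^oo on a neighbourhood of p: all iterated directional derivatives
   exist and are differentiable there. *)
Definition csmooth f p : Prop :=
  \forall q \near p, forall s : seq E,
    differentiable (repart (foldr dder f s)) q /\
    differentiable (impart (foldr dder f s)) q.

Definition cholo f p : Prop :=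
  csmooth f p /\ \forall q \near p, forall j, dzb j f q = 0.

End Calculus.

Definition cpt1 (R : realType) (b : R[i]) : cspace R 1 :=
  (const_mx (complex.Re b), const_mx (complex.Im b)).
Definition cjoin (R : realType) (m n : nat) (p : cspace R m) (q : cspace R n) :
  cspace R (m + n) := (row_mx p.1 q.1, row_mx p.2 q.2).
Definition cfst (R : realType) (m n : nat) (p : cspace R (m + n)) :
  cspace R m := (lsubmx p.1, lsubmx p.2).
Definition csnd (R : realType) (m n : nat) (p : cspace R (m + n)) :
  cspace R n := (rsubmx p.1, rsubmx p.2).

(* [bwd] is only meaningful on the open set [fwd @` cdom]. *)
Record chart (R : realType) (T : topologicalType) (n : nat) := Chart {
  cdom : set T;
  fwd : T -> cspace R n;
  bwd : cspace R n -> T;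
  cdom_open : open cdom;
  ccod_open : open (fwd @` cdom);
  fwdK : forall x, cdom x -> bwd (fwd x) = x;
  fwd_cont : forall x, cdom x -> {for x, continuous fwd};
  bwd_cont : forall p, (fwd @` cdom) p -> {for p, continuous bwd} }.

Definition coord (R : realType) (T : topologicalType) (n : nat)
    (phi : chart R T n) (j : 'I_n) : T -> R[i] :=
  fun x => zc (fwd phi x) j.

Definition transition_holo (R : realType) (T : topologicalType) (n : nat)
    (phi psi : chart R T n) : Prop :=
  forall x, cdom phi x -> cdom psi x ->
  forall j, cholo (coord psi j \o bwd phi) (fwd phi x).

Record cmanifold (R : realType) (n : nat) := CManifold {
  space :> topologicalType;
  space_hausdorff : hausdorff_space space;
  space_second_countable : @second_countable space;
  atlas : set (chart R space n);
  atlas_cover : forall x : space, exists2 phi, atlas phi & cdom phi x;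
  atlas_compat : forall phi psi, atlas phi -> atlas psi ->
    transition_holo phi psi }.

Section Manifold.
Variables (R : realType) (n : nat) (M : cmanifold R n).
Local Notation C := R[i].
Implicit Types (x : M) (f : M -> C).

(* A chart of the maximal atlas. *)
Definition holo_chart (chi : chart R M n) : Prop :=
  forall phi, atlas phi -> transition_holo phi chi /\ transition_holo chi phi.

Definition smooth_near f x : Prop :=
  exists phi, [/\ atlas phi, cdom phi x & csmooth (f \o bwd phi) (fwd phi x)].

Definition holo_near f x : Prop :=
  exists phi, [/\ atlas phi, cdom phi x & cholo (f \o bwd phi) (fwd phi x)].

Definition smooth f : Prop := forall x, smooth_near f x.

(* A complexified tangent vector at x is the derivation
   sum_j (a_j d/dz^j + b_j d/d(conj z^j)) acting on functions that are smooth
   near x; it is extended by the junk value 0 to all other functions, so that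
   equality of vectors is Leibniz equality. *)
Definition vec := (M -> C) -> C.

Definition tangent x (v : vec) : Prop :=
  exists phi, [/\ atlas phi, cdom phi x &
    exists a b : 'I_n -> C, forall f, v f =
      if `[< smooth_near f x >] then
        \sum_j (a j * dz j (f \o bwd phi) (fwd phi x) +
                b j * dzb j (f \o bwd phi) (fwd phi x))
      else 0].

Definition cconj f : M -> C := fun x => (f x)^*.
Definition vconj (v : vec) : vec := fun f => (v (cconj f))^*.
Definition vlin (a : C) (u v : vec) : vec := fun f => a * u f + v f.

(* The complex structure, extended C-linearly: J v is the tangent vector with
   (J v) f = i (v f) and (J v) (conj f) = - i (v (conj f)) for all holomorphic
   f, i.e. J (d/dz^j) = i d/dz^j, J (d/d(conj z^j)) = - i d/d(conj z^j). *)
Definition J x (v : vec) : vec :=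
  xget (fun=> 0) [set w | tangent x w /\
    forall f, holo_near f x ->
      w f = 'i%C * v f /\ w (cconj f) = - 'i%C * v (cconj f)].

Definition tangent10 x (v : vec) : Prop :=
  tangent x v /\ J x v = (fun f => 'i%C * v f).

Definition pi10 x (v : vec) : vec :=
  fun f => (v f - 'i%C * J x v f) / 2%:R.

Definition vfield := M -> vec.

Definition is_vfield (X : vfield) : Prop :=
  (forall x, tangent x (X x)) /\
  (forall f x, smooth_near f x -> smooth_near (fun y => X y f) x).

Definition is_vfield10 (X : vfield) : Prop :=
  is_vfield X /\ forall x, tangent10 x (X x).

Definition flin (h : M -> C) (X Y : vfield) : vfield :=
  fun x => vlin (h x) (X x) (Y x).
Definition fconj (X : vfield) : vfield := fun x => vconj (X x).
Definition fJ (X : vfield) : vfield := fun x => J x (X x).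
Definition fpi10 (X : vfield) : vfield := fun x => pi10 x (X x).
Definition fsub (X Y : vfield) : vfield := fun x f => X x f - Y x f.

Definition bracket (X Y : vfield) : vfield := fun x f =>
  if `[< smooth_near f x >]
  then X x (fun y => Y y f) - Y x (fun y => X y f) else 0.

End Manifold.

Section Maps.
Variables (R : realType) (m n : nat) (M : cmanifold R m) (N : cmanifold R n).

Definition holo_map (F : M -> N) (x : M) : Prop :=
  {for x, continuous F} /\
  forall f, holo_near f (F x) -> holo_near (f \o F) x.

Definition pushforward (F : M -> N) (x : M) (v : vec M) : vec N :=
  fun f => if `[< smooth_near f (F x) >] then v (f \o F) else 0.

End Maps.

(* The metric and the connection are given by their C-(bi)linear extensions to
   the complexified tangent bundle; the fields [metric_real] and [nabla_real]
   say that they come from real objects. *)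
Record special_kahler (R : realType) (m : nat) (M : cmanifold R m) :=
    SpecialKahler {
  metric : M -> vec M -> vec M -> R[i];
  metric_lin : forall x a u v w, tangent x u -> tangent x v -> tangent x w ->
    metric x (vlin a u v) w = a * metric x u w + metric x v w;
  metric_sym : forall x u v, tangent x u -> tangent x v ->
    metric x u v = metric x v u;
  metric_real : forall x u v, tangent x u -> tangent x v ->
    metric x (vconj u) (vconj v) = (metric x u v)^*;
  metric_nondegenerate : forall x u, tangent x u ->
    (forall v, tangent x v -> metric x u v = 0) -> u = (fun=> 0);
  metric_smooth : forall X Y, is_vfield X -> is_vfield Y ->
    smooth (fun x => metric x (X x) (Y x));
  metric_hermitian : forall x u v, tangent x u -> tangent x v ->
    metric x (J x u) (J x v) = metric x u v;
  Phi : vfield M -> vfield M -> M -> R[i] :=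
    fun X Y x => metric x (X x) (J x (Y x));
  Phi_closed : forall X Y Z, is_vfield X -> is_vfield Y -> is_vfield Z ->
    forall x, X x (Phi Y Z) - Y x (Phi X Z) + Z x (Phi X Y)
      - Phi (bracket X Y) Z x + Phi (bracket X Z) Y x
      - Phi (bracket Y Z) X x = 0;
  nabla : vfield M -> vfield M -> vfield M;
  nabla_vfield : forall X Y, is_vfield X -> is_vfield Y ->
    is_vfield (nabla X Y);
  nabla_linl : forall h X Y Z, smooth h ->
    is_vfield X -> is_vfield Y -> is_vfield Z ->
    nabla (flin h X Y) Z = flin h (nabla X Z) (nabla Y Z);
  nabla_leibniz : forall h X Y Z, smooth h ->
    is_vfield X -> is_vfield Y -> is_vfield Z ->
    nabla X (flin h Y Z) =
      flin (fun x => X x h) Y (flin h (nabla X Y) (nabla X Z));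
  nabla_real : forall X Y, is_vfield X -> is_vfield Y ->
    nabla (fconj X) (fconj Y) = fconj (nabla X Y);
  nabla_flat : forall X Y Z, is_vfield X -> is_vfield Y -> is_vfield Z ->
    fsub (nabla X (nabla Y Z)) (nabla Y (nabla X Z)) = nabla (bracket X Y) Z;
  nabla_torsion_free : forall X Y, is_vfield X -> is_vfield Y ->
    fsub (nabla X Y) (nabla Y X) = bracket X Y;
  nabla_Phi : forall X Y Z, is_vfield X -> is_vfield Y -> is_vfield Z ->
    forall x, X x (Phi Y Z) = Phi (nabla X Y) Z x + Phi Y (nabla X Z) x;
  (* d_nabla J = 0 *)
  nabla_dJ : forall X Y, is_vfield X -> is_vfield Y ->
    fsub (fsub (nabla X (fJ Y)) (nabla Y (fJ X))) (fJ (bracket X Y)) =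
      (fun _ _ => 0) }.

(* The holomorphic cubic form Phi(pi10 X, (nabla_Y pi10) Z). *)
Definition cubic (R : realType) (m : nat) (M : cmanifold R m)
    (S : special_kahler M) (X Y Z : vfield M) : M -> R[i] :=
  Phi S (fpi10 X) (fsub (nabla S Y (fpi10 Z)) (fpi10 (nabla S Y Z))).

(* C^x is the set of b <> 0 in R[i]; [act 0] is irrelevant. *)
Record projective_special_kahler (R : realType) (n : nat)
    (Mt : cmanifold R n.+1) (M : cmanifold R n) := ProjectiveSpecialKahler {
  sk :> special_kahler Mt;
  act : R[i] -> Mt -> Mt;
  act_1 : forall x, act 1 x = x;
  act_M : forall a b x, a != 0 -> b != 0 -> act (a * b) x = act a (act b x);
  act_free : forall b x, b != 0 -> act b x = x -> b = 1;
  (* (b, x) |-> act b x is holomorphic on C^x * Mt *)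
  act_holo : forall b x phi, b != 0 -> atlas phi -> cdom phi x ->
    let A (w : cspace R (1 + n.+1)) :=
      act (zc (cfst w) ord0) (bwd phi (csnd w)) in
    let w0 := cjoin (cpt1 b) (fwd phi x) in
    {for w0, continuous A} /\
    forall f, holo_near f (act b x) -> cholo (f \o A) w0;
  proj : Mt -> M;
  proj_surj : forall p, exists x, proj x = p;
  proj_fiber : forall x x',
    proj x = proj x' <-> exists2 b, b != 0 & x' = act b x;
  proj_holo : forall x, holo_map proj x;
  (* x |-> (y x, proj x) and (b, q) |-> act b (s q) are mutually inverse,
     holomorphic and equivariant bijections between the preimage of U and
     C^x * U. *)
  proj_trivial : forall p, exists U (s : M -> Mt) (y : Mt -> R[i]),
    [/\ open U, U p,
      forall q, U q -> holo_map s q /\ proj (s q) = q &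
      forall x, U (proj x) ->
        [/\ holo_near y x, y x != 0 & act (y x) (s (proj x)) = x]];
  cst : R;
  cst_neq0 : cst != 0;
  H : vfield Mt;
  H_vfield10 : is_vfield10 H;
  (* H f (x) = c d/db|_{b = 1} f (act b x) for f holomorphic *)
  H_fundamental : forall x f, holo_near f x ->
    H x f = (cst%:C)%C *
      dz ord0 (fun w : cspace R 1 => f (act (zc w ord0) x)) (cpt1 1);
  nabla_H : forall Y, is_vfield10 Y ->
    nabla sk Y H = (fun x f => (cst%:C)%C * Y x f);
  H_nonisotropic : forall x, metric sk x (H x) (vconj (H x)) != 0 }.

Section Projective.
Variables (R : realType) (n : nat) (Mt : cmanifold R n.+1) (M : cmanifold R n).
Variable P : projective_special_kahler Mt M.
Local Notation C := R[i].

Definition calK (x : Mt) : C :=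
  ((cst P)%:C)%C ^- 2 * metric P x (H P x) (vconj (H P x)).

Definition logK (x : Mt) : C := ((ln (complex.Re `|calK x|))%:C)%C.

(* Holomorphic coordinates (y, z^1, .., z^n) in which the action reads
   (y, z) |-> (b y, z); y has index ord0 and z^i has index lift ord0 i. *)
Definition adapted (chi : chart R Mt n.+1) : Prop :=
  holo_chart chi /\
  forall b x, b != 0 -> cdom chi x ->
    [/\ cdom chi (act P b x),
        coord chi ord0 (act P b x) = b * coord chi ord0 x &
        forall i, coord chi (lift ord0 i) (act P b x) =
                  coord chi (lift ord0 i) x].

(* The connection form omega = dy / y + d/dz^i log|K| dz^i, evaluated on v. *)
Definition omega (chi : chart R Mt n.+1) (x : Mt) (v : vec Mt) : C :=
  (coord chi ord0 x)^-1 * v (coord chi ord0) +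
  \sum_(i < n) dz (lift ord0 i) (logK \o bwd chi) (fwd chi x) *
               v (coord chi (lift ord0 i)).

Definition is_hlift (X : vfield M) (Xt : vfield Mt) : Prop :=
  [/\ is_vfield10 Xt,
      forall x, pushforward (proj P) x (Xt x) = X (proj P x) &
      forall x chi, adapted chi -> cdom chi x -> omega chi x (Xt x) = 0].

(* Definite description: the lift of a (1,0) field is unique. *)
Definition hlift (X : vfield M) : vfield Mt :=
  xget (fun _ _ => 0) [set Xt | is_hlift X Xt].

Definition descended_cubic (X Y Z : vfield M) : Mt -> C :=
  cubic P (hlift X) (hlift Y) (hlift Z).

(* Sections of the k-th power of L^*: s is identified with the function
   f(x) = s([x, H x], .., [x, H x]); since
   [act b x, H (act b x)] = b [x, H x] in L, f is homogeneous of degree k. *)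
Definition section_Lstar (k : nat) (f : Mt -> C) : Prop :=
  smooth f /\ forall b x, b != 0 -> f (act P b x) = b ^+ k * f x.

(* Sections of (L^* )^k (x) (T^*M)^3: maps from triples of (1,0) fields on M to
   sections of (L^* )^k that are linear over the smooth functions on M in each
   argument. *)
Definition section_Lstar_T3 (k : nat)
    (Xi : vfield M -> vfield M -> vfield M -> Mt -> C) : Prop :=
  [/\ forall X Y Z, is_vfield10 X -> is_vfield10 Y -> is_vfield10 Z ->
        section_Lstar k (Xi X Y Z),
      forall h X X' Y Z, smooth h -> is_vfield10 X -> is_vfield10 X' ->
        is_vfield10 Y -> is_vfield10 Z ->
        forall x, Xi (flin h X X') Y Z x =
          h (proj P x) * Xi X Y Z x + Xi X' Y Z x,
      forall h X Y Y' Z, smooth h -> is_vfield10 X -> is_vfield10 Y ->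
        is_vfield10 Y' -> is_vfield10 Z ->
        forall x, Xi X (flin h Y Y') Z x =
          h (proj P x) * Xi X Y Z x + Xi X Y' Z x &
      forall h X Y Z Z', smooth h -> is_vfield10 X -> is_vfield10 Y ->
        is_vfield10 Z -> is_vfield10 Z' ->
        forall x, Xi X Y (flin h Z Z') x =
          h (proj P x) * Xi X Y Z x + Xi X Y Z' x].

End Projective.

(* Main.v *)
From HB Require Import structures.
From Pilot Require Import Defs.
From mathcomp Require Import all_boot all_order all_algebra complex.
From mathcomp Require Import all_classical all_reals all_analysis.
From mathcomp Require Import ring lra.

(* Put Hn = g(H, conj H), a real nowhere vanishing function, and write nabla
   for the flat connection.  Torsion-freeness and d_nabla J = 0 give
   nabla_W H = 0 for W of type (0,1), because [H, W] is again of type (0,1); as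
   nabla_X H = c X and nabla Phi = 0, it follows that X(Hn) = c g(X, conj H) for
   X of type (1,0).  In a chart (y, z) in which the action is multiplication of
   y, H is c y d/dy, so that H(Hn) = c Hn means that omega(v) = v(Hn) / Hn on
   vectors of type (1,0).  Thus a lift is horizontal iff it annihilates Hn,
   equivalently iff it is orthogonal to conj H, and such a lift exists, is
   unique and is smooth, by an explicit formula in the chart.

   For horizontal lifts, [H, X~] and [conj H, X~] are vertical of type (1,0) and
   orthogonal to conj H, hence vanish.  The cubic form of (1,0) fields is
   f = Phi(X, nabla_Y Z), and flatness yields H f = 2 c f, (conj H) f = 0.
   Therefore y^-2 f is constant along the orbits, i.e. f has degree 2.
   Tensoriality in Z holds because Phi(X, Z) = 0 for X, Z of type (1,0). *)

(** The action has to be seen in coordinates, while the axioms only provide local trivialisations.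
    An adapted chart is therefore built from a trivialisation and a chart of the base; the delicate
    point is that its inverse is holomorphic, which comes from the joint holomorphy of the action.
    Since [omega] is tested in all adapted charts, horizontality constrains a lift at a point only
    because such a chart exists there. The two equations for f are integrated without any flow. In
    an adapted chart, acting by 1 + t (b - 1) moves a point along a straight segment in the y
    direction, so the mean value theorem is enough. The segment from 1 to b meets 0 exactly when b
    is real and not positive, whence the separate treatment of negative b. Vectors are functionals
    with value 0 on functions that are not smooth. A tangent vector is then equal, as a function, to
    any other one with the same values on coordinates and their conjugates, and all identities
    between vectors are proved by this comparison. *)

Set Implicit Arguments.
Unset Strict Implicit.
Unset Printing Implicit Defensive.

Import Order.TTheory GRing.Theory Num.Theory.
Import numFieldNormedType.Exports.

Local Open Scope classical_set_scope.
Local Open Scope ring_scope.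

(** * Calculus on C^n *)

#[local] Opaque derive.

Section ComplexNumbers.
Variable R : realType.
Local Notation C := R[i].
Local Notation Re := complex.Re.
Local Notation Im := complex.Im.
Implicit Types z w : C.

Lemma complex_ext z w : Re z = Re w -> Im z = Im w -> z = w.
Proof. by case: z w => a b [c d] /= -> ->. Qed.

Lemma Re_mul z w : Re (z * w) = Re z * Re w - Im z * Im w.
Proof. by case: z w => a b [c d]. Qed.
Lemma Im_mul z w : Im (z * w) = Re z * Im w + Im z * Re w.
Proof. by case: z w => a b [c d]. Qed.
Lemma Re_add z w : Re (z + w) = Re z + Re w.
Proof. by case: z w => a b [c d]. Qed.
Lemma Im_add z w : Im (z + w) = Im z + Im w.
Proof. by case: z w => a b [c d]. Qed.
Lemma Re_opp z : Re (- z) = - Re z. Proof. by case: z. Qed.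
Lemma Im_opp z : Im (- z) = - Im z. Proof. by case: z. Qed.
Lemma Re_conj z : Re z^* = Re z. Proof. by case: z. Qed.
Lemma Im_conj z : Im z^* = - Im z. Proof. by case: z. Qed.
Lemma Re_inv z : Re z^-1 = Re z / (Re z * Re z + Im z * Im z).
Proof. by case: z => a b /=; rewrite -!expr2. Qed.
Lemma Im_inv z : Im z^-1 = - Im z / (Re z * Re z + Im z * Im z).
Proof. by case: z => a b /=; rewrite -!expr2 mulNr. Qed.
Lemma Re_real (a : R) : complex.Re (a%:C)%C = a. Proof. by []. Qed.
Lemma Im_real (a : R) : complex.Im (a%:C)%C = 0. Proof. by []. Qed.
Lemma Re_realM (a : R) z : Re ((a%:C)%C * z) = a * Re z.
Proof. by rewrite Re_mul mul0r subr0. Qed.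
Lemma Im_realM (a : R) z : Im ((a%:C)%C * z) = a * Im z.
Proof. by rewrite Im_mul mul0r addr0. Qed.
Lemma sqi : 'i%C * 'i%C = -1 :> C.
Proof. by rewrite -expr2 sqr_i. Qed.
Lemma conj_i : ('i%C : C)^* = - 'i%C.
Proof. by apply: complex_ext; rewrite ?Re_conj ?Im_conj ?Re_opp ?Im_opp /= ?oppr0. Qed.
Lemma conj_real (a : R) : ((a%:C)%C : C)^* = (a%:C)%C.
Proof. by apply: complex_ext; rewrite ?Re_conj ?Im_conj /= ?oppr0. Qed.
Lemma complex_neq0 z : (z != 0) = (Re z * Re z + Im z * Im z != 0).
Proof.
case: z => a b; rewrite eq_complex /= -!expr2.
by rewrite paddr_eq0 ?sqr_ge0 // !expf_eq0.
Qed.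
End ComplexNumbers.

(** The first order expansion of [f] at [p] also serves for [g], and [diff_unique] identifies its
    linear part with the differential of [g]. *)
Lemma near_eq_differentiable (R : realType) (V W : normedModType R)
    (f g : V -> W) (p : V) :
  (\forall q \near p, f q = g q) -> differentiable f p -> differentiable g p.
Proof.
move=> fg fd.
have gE : g \o shift p = cst (g p) + 'd f p +o_ 0 id.
  apply/eqaddoP => _/posnumP[e].
  have fg0 : \forall y \near 0, f (y + p) = g (y + p).
    by move: fg; rewrite (near_shift 0); apply: filterS => y; rewrite /= subr0.
  have /eqaddoP/(_ _ (gt0 e)) fo := diff_locally fd.
  have fgp := nbhs_singleton fg.
  by apply: filterS2 fg0 fo => y yE; rewrite !fctE /= -fgp yE.
have dfc : continuous ('d f p) := diff_continuous fd.
by apply/diff_locallyP; rewrite (diff_unique dfc gE).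
Qed.

Section FirstOrder.
Variables (R : realType) (m : nat).
Local Notation C := R[i].
Local Notation E := (cspace R m).
Local Notation Re := complex.Re.
Local Notation Im := complex.Im.
Implicit Types (f g : E -> C) (p q v : E).

Definition cdiff f p : Prop :=
  differentiable (repart f) p /\ differentiable (impart f) p.

Lemma repart_dder v f p : Re (dder v f p) = 'D_v (repart f) p. Proof. by []. Qed.
Lemma impart_dder v f p : Im (dder v f p) = 'D_v (impart f) p. Proof. by []. Qed.

#[local] Opaque dder.

Lemma dder_eq_near v f g p : (\forall q \near p, f q = g q) ->
  dder v f p = dder v g p.
Proof.
move=> fg.
by apply: complex_ext; rewrite !(repart_dder, impart_dder); apply: near_eq_derive => //;
   apply: filterS fg => q; rewrite /repart /impart => ->.
Qed.

Lemma cdiff_eq_near f g p : (\forall q \near p, f q = g q) -> cdiff f p -> cdiff g p.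
Proof.
move=> fg [fr fi]; split; [move: fr|move: fi]; apply: near_eq_differentiable;
by apply: filterS fg => q; rewrite /repart /impart => ->.
Qed.

Lemma cdiff_cst (c : C) p : cdiff (fun=> c) p.
Proof. by split; apply: differentiable_cst. Qed.

Lemma dder_cst v (c : C) p : dder v (fun=> c) p = 0.
Proof. by apply: complex_ext; rewrite !(repart_dder, impart_dder) derive_cst. Qed.

Lemma cdiffD f g p : cdiff f p -> cdiff g p -> cdiff (fun q => f q + g q) p.
Proof.
move=> [fr fi] [gr gi]; split.
  rewrite (_ : repart _ = repart f + repart g); first exact: differentiableD.
  by apply/funext => q; rewrite /repart Re_add.
rewrite (_ : impart _ = impart f + impart g); first exact: differentiableD.
by apply/funext => q; rewrite /impart Im_add.
Qed.

Lemma dderD v f g p : cdiff f p -> cdiff g p ->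
  dder v (fun q => f q + g q) p = dder v f p + dder v g p.
Proof.
move=> [fr fi] [gr gi]; apply: complex_ext; rewrite ?Re_add ?Im_add !(repart_dder, impart_dder).
  rewrite -deriveD; [|exact: diff_derivable..].
  rewrite (_ : repart _ = repart f + repart g) //.
  by apply/funext => q; rewrite /repart Re_add.
rewrite -deriveD; [|exact: diff_derivable..].
rewrite (_ : impart _ = impart f + impart g) //.
by apply/funext => q; rewrite /impart Im_add.
Qed.

Lemma cdiffM f g p : cdiff f p -> cdiff g p -> cdiff (fun q => f q * g q) p.
Proof.
move=> [fr fi] [gr gi]; split.
  rewrite (_ : repart _ = repart f * repart g - impart f * impart g).
    by apply: differentiableB; apply: differentiableM.
  by apply/funext => q; rewrite /repart Re_mul.
rewrite (_ : impart _ = repart f * impart g + impart f * repart g).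
  by apply: differentiableD; apply: differentiableM.
by apply/funext => q; rewrite /impart Im_mul.
Qed.

Lemma dderM v f g p : cdiff f p -> cdiff g p ->
  dder v (fun q => f q * g q) p = f p * dder v g p + g p * dder v f p.
Proof.
move=> [fr fi] [gr gi].
have dM (a b : E -> R) : differentiable a p -> differentiable b p ->
    derivable (a * b) p v /\ 'D_v (a * b) p = a p * 'D_v b p + b p * 'D_v a p.
  move=> da db; have ha : derivable a p v by exact: diff_derivable.
  have hb : derivable b p v by exact: diff_derivable.
  by split; [exact: (derivableM ha hb) | exact: (deriveM ha hb)].
apply: complex_ext; rewrite ?(Re_add, Im_add, Re_mul, Im_mul) !(repart_dder, impart_dder).
  rewrite (_ : repart _ = repart f * repart g - impart f * impart g); last first.
    by apply/funext => q; rewrite /repart Re_mul.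
  have [h1 e1] := dM _ _ fr gr; have [h2 e2] := dM _ _ fi gi.
  rewrite (deriveB h1 h2) e1 e2 /repart /impart; ring.
rewrite (_ : impart _ = repart f * impart g + impart f * repart g); last first.
  by apply/funext => q; rewrite /impart Im_mul.
have [h1 e1] := dM _ _ fr gi; have [h2 e2] := dM _ _ fi gr.
rewrite (deriveD h1 h2) e1 e2 /repart /impart; ring.
Qed.

Lemma cdiffJ f p : cdiff f p -> cdiff (fun q => (f q)^*) p.
Proof.
move=> [fr fi]; split; last first.
  rewrite (_ : impart _ = - impart f); first exact: differentiableN.
  by apply/funext => q; rewrite /impart Im_conj.
rewrite (_ : repart _ = repart f) //.
by apply/funext => q; rewrite /repart Re_conj.
Qed.

Lemma dderJ v f p : cdiff f p -> dder v (fun q => (f q)^*) p = (dder v f p)^*.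
Proof.
move=> [fr fi]; apply: complex_ext; rewrite ?Re_conj ?Im_conj !(repart_dder, impart_dder).
  rewrite (_ : repart _ = repart f) //.
  by apply/funext => q; rewrite /repart Re_conj.
rewrite -deriveN; last exact: diff_derivable.
rewrite (_ : impart _ = - impart f) //.
by apply/funext => q; rewrite /impart Im_conj.
Qed.

Lemma cdiff_neq0_near f p : cdiff f p -> f p != 0 -> \forall q \near p, f q != 0.
Proof.
move=> [fr fi]; rewrite complex_neq0 => fp0.
pose h := repart f * repart f + impart f * impart f.
have hc : {for p, continuous h}.
  by apply: differentiable_continuous; apply: differentiableD; apply: differentiableM.
have : \forall q \near p, h q != 0.
  by apply: (hc [set r | r != 0]); apply: open_nbhs_nbhs; split => //; apply: open_neq.
by apply: filterS => q; rewrite complex_neq0.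
Qed.

Lemma cdiffV f p : cdiff f p -> f p != 0 -> cdiff (fun q => (f q)^-1) p.
Proof.
move=> [fr fi]; rewrite complex_neq0 => fp0.
pose h := repart f * repart f + impart f * impart f.
have hd : differentiable h p by apply: differentiableD; apply: differentiableM.
have hV : differentiable (fun q => (h q)^-1) p by apply: differentiableV.
split.
  rewrite (_ : repart _ = repart f * (fun q => (h q)^-1)); first exact: differentiableM.
  by apply/funext => q; rewrite /repart Re_inv.
rewrite (_ : impart _ = - impart f * (fun q => (h q)^-1)).
  by apply: differentiableM => //; apply: differentiableN.
by apply/funext => q; rewrite /impart Im_inv.
Qed.

(** Obtained by differentiating the product of [f] and its inverse, which is constantly 1 near
    [p]. *)
Lemma dderV v f p : cdiff f p -> f p != 0 ->
  dder v (fun q => (f q)^-1) p = - (f p)^-1 * (f p)^-1 * dder v f p.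
Proof.
move=> fd fp0; have fVd := cdiffV fd fp0.
have := dderM v fd fVd.
rewrite (@dder_eq_near v _ (fun=> 1)); last first.
  by apply: filterS (cdiff_neq0_near fd fp0) => q q0; rewrite divff.
rewrite dder_cst => /eqP; rewrite eq_sym addr_eq0 => /eqP h.
by apply: (mulfI fp0); rewrite h; field.
Qed.

Lemma cspace_decomp v :
  v = \sum_j (v.1 ord0 j *: ex R j + v.2 ord0 j *: ey R j).
Proof.
have fst_sum (F : 'I_m -> E) : (\sum_j F j).1 = \sum_j (F j).1 by apply: (big_morph fst).
have snd_sum (F : 'I_m -> E) : (\sum_j F j).2 = \sum_j (F j).2 by apply: (big_morph snd).
rewrite [LHS]surjective_pairing [RHS]surjective_pairing fst_sum snd_sum.
congr pair; rewrite [LHS]row_sum_delta; apply: eq_bigr => j _ /=.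
  by rewrite scaler0 addr0.
by rewrite scaler0 add0r.
Qed.

(** The differential of [f] is only real linear, so a direction acts through its complex coordinates
    and their conjugates: x d/dx + y d/dy = z d/dz + conj z d/d(conj z). *)
Lemma dder_wirtinger v f p : cdiff f p ->
  dder v f p = \sum_j (zc v j * dz j f p + (zc v j)^* * dzb j f p).
Proof.
move=> [fr fi].
have key (h : E -> R) : differentiable h p ->
  'D_v h p = \sum_j (v.1 ord0 j * 'D_(ex R j) h p + v.2 ord0 j * 'D_(ey R j) h p).
  move=> hd; rewrite deriveE // {1}[v]cspace_decomp linear_sum.
  by apply: eq_bigr => j _; rewrite linearD !linearZ /= !deriveE.
transitivity (\sum_j ((v.1 ord0 j)%:C%C * dder (ex R j) f p +
                      (v.2 ord0 j)%:C%C * dder (ey R j) f p)).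
  apply: complex_ext.
    rewrite repart_dder key // (big_morph (@complex.Re R) (@Re_add R) (erefl _)).
    apply: eq_bigr => j _; move: (repart_dder (ex R j) f p) (repart_dder (ey R j) f p).
    move: (dder _ f p) (dder _ f p) ('D_(ex R j) _ p) ('D_(ey R j) _ p) => A B a b <- <-.
    by rewrite Re_add !Re_realM.
  rewrite impart_dder key // (big_morph (@complex.Im R) (@Im_add R) (erefl _)).
  apply: eq_bigr => j _; move: (impart_dder (ex R j) f p) (impart_dder (ey R j) f p).
  move: (dder _ f p) (dder _ f p) ('D_(ex R j) _ p) ('D_(ey R j) _ p) => A B a b <- <-.
  by rewrite Im_add !Im_realM.
apply: eq_bigr => j _; rewrite /dz /dzb.
set A := dder _ f p; set B := dder _ f p.
have -> : zc v j = (v.1 ord0 j)%:C%C + 'i%C * (v.2 ord0 j)%:C%C by rewrite [LHS]complexE.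
rewrite rmorphD rmorphM /= !conj_real conj_i.
set a := (_%:C)%C; set b := (_%:C)%C.
have n2 : 2%:R != 0 :> C by rewrite pnatr_eq0.
(* [field] treats the imaginary unit as an atom, so its square is inserted by hand. *)
rewrite (_ : a * A + b * B = a * A - 'i%C * 'i%C * (b * B)); last by rewrite sqi; ring.
by field.
Qed.

End FirstOrder.

Section Chain.
Variables (R : realType) (m n : nat).
Local Notation C := R[i].
Local Notation Em := (cspace R m).
Local Notation En := (cspace R n).
Local Notation Re := complex.Re.
Local Notation Im := complex.Im.
Implicit Types (g : En -> C) (T : Em -> En) (p v : Em).

Lemma differentiable_comp_coord T p : (forall j, cdiff (fun q => zc (T q) j) p) ->
  differentiable T p /\ forall v, 'D_v T p =
    \sum_j ('D_v (repart (fun q => zc (T q) j)) p *: ex R j +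
            'D_v (impart (fun q => zc (T q) j)) p *: ey R j).
Proof.
move=> dT.
pose F j : Em -> En := (fun q => repart (fun q => zc (T q) j) q *: ex R j) +
  (fun q => impart (fun q => zc (T q) j) q *: ey R j).
have TE : T = \sum_j F j.
  by apply/funext => q; rewrite fct_sumE [LHS]cspace_decomp.
have dF j : differentiable (F j) p.
  by have [? ?] := dT j; apply: differentiableD; apply: differentiableZl.
have dd : differentiable T p by rewrite TE; apply: differentiable_sum.
split=> // v; rewrite {1}TE derive_sum; last by move=> j; apply: diff_derivable.
apply: eq_bigr => j _; have [? ?] := dT j.
have DZ (k : Em -> R) (w : En) : differentiable k p ->
    derivable (fun q => k q *: w) p v /\ 'D_v (fun q => k q *: w) p = 'D_v k p *: w.
  move=> dk; have dkw := differentiableZl w dk.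
  split; first exact: diff_derivable.
  by rewrite (deriveE _ dkw) (deriveE _ dk) (diffZl w dk).
have [d1 e1] := DZ (repart (fun q => zc (T q) j)) (ex R j) ltac:(assumption).
have [d2 e2] := DZ (impart (fun q => zc (T q) j)) (ey R j) ltac:(assumption).
by rewrite /F (deriveD d1 d2) e1 e2.
Qed.

Lemma cdiff_comp g T p : (forall j, cdiff (fun q => zc (T q) j) p) ->
  cdiff g (T p) -> cdiff (g \o T) p.
Proof.
move=> /differentiable_comp_coord[dT _] [gr gi].
split; [exact: (@differentiable_comp _ _ _ _ T (repart g))
       |exact: (@differentiable_comp _ _ _ _ T (impart g))].
Qed.

Lemma dder_comp g T p v : (forall j, cdiff (fun q => zc (T q) j) p) ->
  cdiff g (T p) ->
  dder v (g \o T) p =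
  \sum_j (dder v (fun q => zc (T q) j) p * dz j g (T p) +
          dder v (fun q => (zc (T q) j)^*) p * dzb j g (T p)).
Proof.
move=> dTj gd; have [dT DT] := differentiable_comp_coord dTj.
(* Only the real chain rule is used here; the complex form then comes from expanding the direction
   ['D_v T p]. *)
have -> : dder v (g \o T) p = dder ('D_v T p) g (T p).
  have [gr gi] := gd.
  apply: complex_ext; rewrite !(repart_dder, impart_dder).
    rewrite (deriveE v (differentiable_comp dT gr : differentiable (repart (g \o T)) p)).
    by rewrite !deriveE // (diff_comp dT gr).
  rewrite (deriveE v (differentiable_comp dT gi : differentiable (impart (g \o T)) p)).
  by rewrite !deriveE // (diff_comp dT gi).
rewrite dder_wirtinger //; apply: eq_bigr => j _.
have -> : zc ('D_v T p) j = dder v (fun q => zc (T q) j) p.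
  rewrite DT /dder.
  pose w : En := (\row_j 'D_v (repart (fun q => zc (T q) j)) p,
                  \row_j 'D_v (impart (fun q => zc (T q) j)) p).
  transitivity (zc w j); last by rewrite /zc /w /= !mxE.
  congr (zc _ j); rewrite [RHS]cspace_decomp.
  by apply: eq_bigr => k _; rewrite /w /= !mxE.
by rewrite dderJ.
Qed.

End Chain.

Section Coordinates.
Variables (R : realType) (m : nat).
Local Notation C := R[i].
Local Notation E := (cspace R m).
Implicit Types (p v : E) (j k : 'I_m).

Lemma derive_linear (f : {linear E -> R}) p v : continuous f ->
  differentiable f p /\ 'D_v f p = f v.
Proof.
move=> fc; have fd : differentiable f p by apply: linear_differentiable.
by split=> //; rewrite (deriveE v fd) (diff_lin p fc).
Qed.

Definition recoord j p : R := p.1 ord0 j.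
Definition imcoord j p : R := p.2 ord0 j.

Lemma recoord_is_linear j : linear (recoord j : E -> R).
Proof. by move=> a x y; rewrite /recoord /= !mxE. Qed.
Lemma imcoord_is_linear j : linear (imcoord j : E -> R).
Proof. by move=> a x y; rewrite /imcoord /= !mxE. Qed.

HB.instance Definition _ j :=
  GRing.isLinear.Build R E R *:%R (recoord j) (recoord_is_linear j).
HB.instance Definition _ j :=
  GRing.isLinear.Build R E R *:%R (imcoord j) (imcoord_is_linear j).

Lemma recoord_continuous j : continuous (recoord j : E -> R).
Proof.
move=> p; apply: (@continuous_comp _ _ _ (fst : E -> 'rV[R]_m) (fun u => u ord0 j)).
  exact: cvg_fst.
exact: coord_continuous.
Qed.
Lemma imcoord_continuous j : continuous (imcoord j : E -> R).
Proof.
move=> p; apply: (@continuous_comp _ _ _ (snd : E -> 'rV[R]_m) (fun u => u ord0 j)).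
  exact: cvg_snd.
exact: coord_continuous.
Qed.

Lemma cdiff_zc j p : cdiff (fun q => zc q j) p.
Proof.
split; first exact: (derive_linear p 0 (@recoord_continuous j)).1.
exact: (derive_linear p 0 (@imcoord_continuous j)).1.
Qed.

Lemma dder_zc v j p : dder v (fun q => zc q j) p = zc v j.
Proof.
apply: complex_ext; rewrite ?repart_dder ?impart_dder.
  exact: (derive_linear p v (@recoord_continuous j)).2.
exact: (derive_linear p v (@imcoord_continuous j)).2.
Qed.

Definition cpack (u : 'I_m -> C) : E :=
  (\row_j complex.Re (u j), \row_j complex.Im (u j)).

Lemma zc_cpack u j : zc (cpack u) j = u j.
Proof. by apply: complex_ext; rewrite /= mxE. Qed.

Lemma cpackK p : cpack (zc p) = p.
Proof. by case: p => a b; congr pair; apply/rowP => j; rewrite mxE. Qed.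

Lemma cspace_ext p q : (forall j, zc p j = zc q j) -> p = q.
Proof. by move=> pq; rewrite -[p]cpackK -[q]cpackK; congr cpack; apply/funext. Qed.

Lemma zc_lin (a : R) v p j : zc (a *: v + p) j = (a%:C)%C * zc v j + zc p j.
Proof.
apply: complex_ext; rewrite ?Re_add ?Im_add ?Re_realM ?Im_realM.
  exact: recoord_is_linear.
exact: imcoord_is_linear.
Qed.

Lemma zc_ex j k : zc (ex R j : E) k = (k == j)%:R :> C.
Proof. by apply: complex_ext; rewrite /= !mxE /=; case: (k == j). Qed.
Lemma zc_ey j k : zc (ey R j : E) k = 'i%C * (k == j)%:R :> C.
Proof.
by apply: complex_ext; rewrite ?Re_mul ?Im_mul /= !mxE /=; case: (k == j); rewrite /=; lra.
Qed.

End Coordinates.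

(** * Complex tangent vectors in coordinates *)

Section Wirtinger.
Variables (R : realType) (m : nat).
Local Notation C := R[i].
Local Notation E := (cspace R m).
Implicit Types (f g : E -> C) (p q v : E) (a b : 'I_m -> C).

(** The complex tangent vector at [p] with components [a] along d/dz^j and [b] along d/d(conj z^j),
    applied to [f]. *)
Definition wirt a b p f : C := \sum_j (a j * dz j f p + b j * dzb j f p).

Lemma two_neq0 : (2%:R : C) != 0. Proof. by rewrite pnatr_eq0. Qed.
Local Hint Resolve two_neq0 : core.

(** In terms of real directional derivatives, locality and the product rule carry over from
    [dder]. *)
Lemma wirtE a b p f : wirt a b p f =
  \sum_j ((a j + b j) / 2%:R * dder (ex R j) f p +
          'i%C * (b j - a j) / 2%:R * dder (ey R j) f p).
Proof.
apply: eq_bigr => j _; rewrite /dz /dzb.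
by move: (dder _ f p) (dder _ f p) => A B; field.
Qed.

Lemma wirt_eq_near a b f g p : (\forall q \near p, f q = g q) ->
  wirt a b p f = wirt a b p g.
Proof.
move=> fg; rewrite !wirtE; apply: eq_bigr => j _.
by rewrite !(dder_eq_near _ fg).
Qed.

Lemma wirt_cst a b (c : C) p : wirt a b p (fun=> c) = 0.
Proof. by rewrite wirtE big1 // => j _; rewrite !dder_cst !mulr0 addr0. Qed.

Lemma wirtM a b f g p : cdiff f p -> cdiff g p ->
  wirt a b p (fun q => f q * g q) = f p * wirt a b p g + g p * wirt a b p f.
Proof.
move=> fd gd; rewrite !wirtE !mulr_sumr -big_split; apply: eq_bigr => j _ /=.
rewrite !dderM //.
move: (dder (ex R j) f p) (dder (ey R j) f p) (dder (ex R j) g p)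
  (dder (ey R j) g p) => A B A' B'; ring.
Qed.

Lemma conj2 : (2%:R : C)^* = 2%:R. Proof. by rewrite conjC_nat. Qed.

Lemma dzJ j f p : cdiff f p -> dz j (fun q => (f q)^*) p = (dzb j f p)^*.
Proof.
move=> fd; rewrite /dz /dzb !dderJ // rmorphM rmorphD rmorphM /= conj_i fmorphV /= conj2.
by rewrite mulNr.
Qed.

Lemma dzbJ j f p : cdiff f p -> dzb j (fun q => (f q)^*) p = (dz j f p)^*.
Proof.
move=> fd; rewrite /dz /dzb !dderJ // rmorphM rmorphB rmorphM /= conj_i fmorphV /= conj2.
by rewrite mulNr opprK.
Qed.

Lemma wirtJ a b f p : cdiff f p -> wirt a b p (fun q => (f q)^*) =
  (wirt (fun j => (b j)^*) (fun j => (a j)^*) p f)^*.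
Proof.
move=> fd; rewrite /wirt rmorph_sum; apply: eq_bigr => j _.
by rewrite dzJ // dzbJ // rmorphD !rmorphM /= !conjCK addrC.
Qed.

Lemma wirt_lin a b a' b' (c : C) p f :
  wirt (fun j => c * a j + a' j) (fun j => c * b j + b' j) p f =
  c * wirt a b p f + wirt a' b' p f.
Proof.
rewrite /wirt mulr_sumr -big_split; apply: eq_bigr => j _ /=; ring.
Qed.

Lemma dz_zc j k p : dz j (fun q => zc q k) p = (k == j)%:R.
Proof.
rewrite /dz !dder_zc zc_ex zc_ey mulrA sqi mulN1r opprK.
by case: (k == j); rewrite /=; field.
Qed.
Lemma dzb_zc j k p : dzb j (fun q => zc q k) p = 0.
Proof.
by rewrite /dzb !dder_zc zc_ex zc_ey mulrA sqi mulN1r subrr mul0r.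
Qed.

Lemma wirt_zc a b k p : wirt a b p (fun q => zc q k) = a k.
Proof.
rewrite /wirt (bigD1 k) //= big1 => [|j jk].
  by rewrite dz_zc dzb_zc eqxx mulr1 mulr0 !addr0.
by rewrite dz_zc dzb_zc eq_sym (negbTE jk) !mulr0 addr0.
Qed.

Lemma wirt_zcJ a b k p : wirt a b p (fun q => (zc q k)^*) = b k.
Proof. by rewrite wirtJ; [rewrite wirt_zc conjCK | exact: cdiff_zc]. Qed.

Lemma dz_wirt j f p : dz j f p = wirt (fun k => (k == j)%:R) (fun=> 0) p f.
Proof.
rewrite /wirt (bigD1 j) //= big1 => [|k /negbTE kj]; last by rewrite kj !mul0r addr0.
by rewrite eqxx mul1r mul0r !addr0.
Qed.
Lemma dzb_wirt j f p : dzb j f p = wirt (fun=> 0) (fun k => (k == j)%:R) p f.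
Proof.
rewrite /wirt (bigD1 j) //= big1 => [|k /negbTE kj]; last by rewrite kj !mul0r addr0.
by rewrite eqxx mul1r mul0r add0r addr0.
Qed.

End Wirtinger.

Section WirtingerChain.
Variables (R : realType) (m n : nat).
Local Notation C := R[i].

(** A complex vector is a complex combination of real directions, so the real chain rule extends by
    linearity: the components of the image vector are its values on the coordinates of [T] and on
    their conjugates. *)
Lemma wirt_comp a b (g : cspace R n -> C) (T : cspace R m -> cspace R n) p :
  (forall j, cdiff (fun q => zc (T q) j) p) -> cdiff g (T p) ->
  wirt a b p (g \o T) =
  wirt (fun j => wirt a b p (fun q => zc (T q) j))
       (fun j => wirt a b p (fun q => (zc (T q) j)^*)) (T p) g.
Proof.
move=> dT dg; rewrite wirtE.
transitivity (\sum_k \sum_j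
  (((a k + b k) / 2%:R * dder (ex R k) (fun q => zc (T q) j) p +
          'i%C * (b k - a k) / 2%:R * dder (ey R k) (fun q => zc (T q) j) p) * dz j g (T p) +
   ((a k + b k) / 2%:R * dder (ex R k) (fun q => (zc (T q) j)^*) p +
          'i%C * (b k - a k) / 2%:R * dder (ey R k) (fun q => (zc (T q) j)^*) p) * dzb j g (T p))).
  apply: eq_bigr => k _; rewrite !dder_comp // !mulr_sumr -big_split.
  apply: eq_bigr => j _ /=.
  move: (dder (ex R k) _ p) (dder (ey R k) _ p) (dder (ex R k) _ p)
    (dder (ey R k) _ p) => A B A' B'.
  by move: (dz _ _ _) (dzb _ _ _) => D D'; ring.
rewrite exchange_big; apply: eq_bigr => j _ /=.
by rewrite big_split /= -!mulr_suml !wirtE.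
Qed.

End WirtingerChain.

(** * Stability of smoothness under algebraic operations and composition *)

Section SmoothOn.
Variable R : realType.
Local Notation C := R[i].

Definition smooth_on m (U : set (cspace R m)) (f : cspace R m -> C) : Prop :=
  forall s q, U q -> cdiff (foldr (@dder R m) f s) q.

Lemma csmoothP m (f : cspace R m -> C) p :
  csmooth f p <-> exists U, [/\ open U, U p & smooth_on U f].
Proof.
split=> [|[U [Uo Up Uf]]].
  rewrite /csmooth /prop_near1 nbhsE => -[U [Uo Up] Uf].
  by exists U; split=> // s q Uq; apply: Uf.
by apply: filterS (open_nbhs_nbhs (conj Uo Up)) => q Uq s; apply: Uf.
Qed.

Lemma smooth_on_dder m (U : set (cspace R m)) v f :
  smooth_on U f -> smooth_on U (dder v f).
Proof. by move=> Uf s q Uq; have := Uf (rcons s v) q Uq; rewrite foldr_rcons. Qed.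

(** A coinduction principle: as [U] is open, equality on [U] passes to derivatives, so every
    iterated derivative of a member of [S] agrees on [U] with a member of [S]. *)
Lemma smooth_on_coind m (U : set (cspace R m)) (S : set (cspace R m -> C)) :
  open U -> (forall f q, S f -> U q -> cdiff f q) ->
  (forall f v, S f -> exists2 g, S g & forall q, U q -> dder v f q = g q) ->
  forall f, S f -> smooth_on U f.
Proof.
move=> Uo Sd SD f Sf.
have eqU (h g : cspace R m -> C) q : U q -> (forall q, U q -> h q = g q) ->
    \forall q' \near q, h q' = g q'.
  by move=> Uq hg; apply: filterS (open_nbhs_nbhs (conj Uo Uq)) => q'; apply: hg.
suff H s : exists2 g, S g & forall q, U q -> foldr (@dder R m) f s q = g q.
  move=> s q Uq; have [g Sg fg] := H s.
  by apply: (@cdiff_eq_near _ _ g); [apply: eqU => // q' /fg | exact: Sd].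
elim: s => [|v s [g Sg fg]] /=; first by exists f.
have [h Sh gh] := SD _ v Sg; exists h => // q Uq.
by rewrite -gh //; apply: dder_eq_near; apply: eqU.
Qed.

(* Closing the smooth functions under all the operations at once makes the
   derivative of an expression an expression again, so that no formula for the
   iterated derivatives of a composition is needed. *)
Inductive smooth_expr m (U : set (cspace R m)) : (cspace R m -> C) -> Prop :=
| SmoothBase f : smooth_on U f -> smooth_expr U f
| SmoothCst c : smooth_expr U (fun=> c)
| SmoothAdd f g : smooth_expr U f -> smooth_expr U g ->
    smooth_expr U (fun q => f q + g q)
| SmoothMul f g : smooth_expr U f -> smooth_expr U g ->
    smooth_expr U (fun q => f q * g q)
| SmoothConj f : smooth_expr U f -> smooth_expr U (fun q => (f q)^*)
| SmoothInv f : smooth_expr U f -> (forall q, U q -> f q != 0) ->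
    smooth_expr U (fun q => (f q)^-1)
| SmoothComp n (V : set (cspace R n)) T g : (forall q, U q -> V (T q)) ->
    (forall j, smooth_expr U (fun q => zc (T q) j)) -> smooth_on V g ->
    smooth_expr U (g \o T).

Lemma SmoothSum m (U : set (cspace R m)) (I : finType) (F : I -> cspace R m -> C) :
  (forall i, smooth_expr U (F i)) -> smooth_expr U (fun q => \sum_i F i q).
Proof.
move=> UF; elim: (index_enum I) => [|i r IH].
  by rewrite (_ : (fun _ => _) = fun=> 0); [exact: SmoothCst|apply/funext => q; rewrite big_nil].
rewrite (_ : (fun _ => _) = fun q => F i q + \sum_(i <- r) F i q).
  exact: SmoothAdd.
by apply/funext => q; rewrite big_cons.
Qed.

(** Exactly the two closure conditions that [smooth_on_coind] asks of the class of expressions. *)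
Lemma smooth_expr_diff m (U : set (cspace R m)) f : smooth_expr U f ->
  (forall q, U q -> cdiff f q) /\
  forall v, exists2 g, smooth_expr U g & forall q, U q -> dder v f q = g q.
Proof.
elim=> {f} [f Uf|c|f g Uf [fd fD] Ug [gd gD]|f g Uf [fd fD] Ug [gd gD]
  |f Uf [fd fD]|f Uf [fd fD] f0|n V T g UV UT IH Vg].
- split=> [q /(Uf [::])//|v]; exists (dder v f) => //.
  exact/SmoothBase/smooth_on_dder.
- split=> [q _|v]; first exact: cdiff_cst.
  by exists (fun=> 0) => [|q _]; [exact: SmoothCst|rewrite dder_cst].
- split=> [q Uq|v]; first by apply: cdiffD; [apply: fd|apply: gd].
  have [f' Uf' f'E] := fD v; have [g' Ug' g'E] := gD v.
  exists (fun q => f' q + g' q) => [|q Uq]; first exact: SmoothAdd.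
  by rewrite dderD ?f'E ?g'E //; [apply: fd|apply: gd].
- split=> [q Uq|v]; first by apply: cdiffM; [apply: fd|apply: gd].
  have [f' Uf' f'E] := fD v; have [g' Ug' g'E] := gD v.
  exists (fun q => f q * g' q + g q * f' q) => [|q Uq].
    by apply: SmoothAdd; apply: SmoothMul.
  by rewrite dderM ?f'E ?g'E //; [apply: fd|apply: gd].
- split=> [q Uq|v]; first by apply: cdiffJ; apply: fd.
  have [f' Uf' f'E] := fD v; exists (fun q => (f' q)^*) => [|q Uq]; first exact: SmoothConj.
  by rewrite dderJ ?f'E //; apply: fd.
- split=> [q Uq|v]; first by apply: cdiffV; [apply: fd|apply: f0].
  have [f' Uf' f'E] := fD v.
  (* Expressions have no constructor for opposites, so the sign is a constant factor. *)
  exists (fun q => ((-1) * (f q)^-1) * (f q)^-1 * f' q) => [|q Uq].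
    have fV := SmoothInv Uf f0.
    by do 3?apply: SmoothMul => //; apply: SmoothCst.
  by rewrite dderV ?f'E ?mulN1r //; [apply: fd|apply: f0].
- have Td q j : U q -> cdiff (fun q => zc (T q) j) q by move=> Uq; apply: (IH j).1.
  split=> [q Uq|v].
    by apply: cdiff_comp => [j|]; [exact: Td|exact: (Vg [::] _ (UV _ Uq))].
  have D1 j : exists h, smooth_expr U h /\
      forall q, U q -> dder v (fun q => zc (T q) j) q = h q.
    by have [h ? ?] := (IH j).2 v; exists h.
  have [F FP] := boolp.choice D1.
  have VD w := smooth_on_dder w Vg.
  pose A j := dder (ex R j) g \o T; pose B j := dder (ey R j) g \o T.
  (* The chain rule with [dz] and [dzb] unfolded: the derivatives of [g] are smooth on [V], so
     composing them with [T] gives expressions again. *)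
  exists (fun q => \sum_j (F j q * ((A j q + (- 'i%C) * B j q) * (2%:R)^-1) +
                    (F j q)^* * ((A j q + 'i%C * B j q) * (2%:R)^-1))) => [|q Uq].
    have UA j : smooth_expr U (A j) by exact: (SmoothComp UV).
    have UB j : smooth_expr U (B j) by exact: (SmoothComp UV).
    have UF j : smooth_expr U (F j) := (FP j).1.
    have cU c := SmoothCst U c.
    apply: SmoothSum => j.
    have UAB c := SmoothMul (SmoothAdd (UA j) (SmoothMul (cU c) (UB j))) (cU (2%:R)^-1).
    exact: (SmoothAdd (SmoothMul (UF j) (UAB _)) (SmoothMul (SmoothConj (UF j)) (UAB _))).
  rewrite dder_comp; [|by move=> j; exact: Td|exact: (Vg [::] _ (UV _ Uq))].
  apply: eq_bigr => j _; rewrite /dz /dzb -/(A j q) -/(B j q) /A /B /= mulNr.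
  by rewrite dderJ ?(FP j).2 //; exact: Td.
Qed.

Lemma smooth_expr_on m (U : set (cspace R m)) f :
  open U -> smooth_expr U f -> smooth_on U f.
Proof.
move=> Uo; apply: (smooth_on_coind Uo) => {}f.
  by move=> q /smooth_expr_diff[fd _]; apply: fd.
by move=> v /smooth_expr_diff[_ fD]; apply: fD.
Qed.

End SmoothOn.

Section SmoothAt.
Variable R : realType.
Local Notation C := R[i].

Lemma csmooth_cdiff m (f : cspace R m -> C) p : csmooth f p -> cdiff f p.
Proof. by move=> /nbhs_singleton/(_ [::]). Qed.

Lemma csmooth_near m (f : cspace R m -> C) p :
  csmooth f p -> \forall q \near p, csmooth f q.
Proof. exact: nbhs_interior. Qed.

Lemma csmooth_dder m v (f : cspace R m -> C) p : csmooth f p -> csmooth (dder v f) p.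
Proof.
move=> /csmoothP[U [Uo Up Uf]]; apply/csmoothP; exists U; split=> //.
exact: smooth_on_dder.
Qed.

Lemma csmooth_eq_near m (f g : cspace R m -> C) p :
  (\forall q \near p, f q = g q) -> csmooth f p -> csmooth g p.
Proof.
move=> /nbhs_interior fg sf; rewrite /csmooth.
apply: filterS2 fg sf => q fgq sfq s.
suff fgs : \forall q' \near q, foldr (@dder R m) f s q' = foldr (@dder R m) g s q'.
  exact: cdiff_eq_near fgs (sfq s).
elim: s => [|v s /nbhs_interior IH] //=.
by apply: filterS IH => q'; apply: dder_eq_near.
Qed.

Lemma csmooth_expr m (U : set (cspace R m)) f p :
  open U -> U p -> smooth_expr U f -> csmooth f p.
Proof.
by move=> Uo Up Uf; apply/csmoothP; exists U; split=> //; apply: smooth_expr_on.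
Qed.

(** Provides one open set for finitely many functions, because all constituents of an expression
    must be smooth on the same [U]. *)
Lemma csmooth_open m I (F : I -> cspace R m -> C) p (P : set (cspace R m)) (r : seq I) :
  (forall i, csmooth (F i) p) -> nbhs p P ->
  exists U, [/\ open U, U p, U `<=` P & forall i, List.In i r -> smooth_on U (F i)].
Proof.
move=> sF pP.
have : nbhs p [set q | P q /\
    forall i, List.In i r -> forall s, cdiff (foldr (@dder R m) (F i) s) q].
  elim: r => [|i r IH]; first by apply: filterS pP => q Pq; split.
  apply: filterS2 (sF i) IH => q sFq [Pq IH]; split=> // j [<-|jr] s; first exact: sFq.
  exact: IH.
rewrite nbhsE => -[U [Uo Up] UP]; exists U; split=> //.
  by move=> q /UP[].
by move=> i ir s q /UP[_]; apply.
Qed.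

(** [T] is differentiable, hence continuous at [p], so a small enough open set on which all its
    coordinates are smooth is sent into the open set where [g] is smooth. *)
Lemma csmooth_comp m n (g : cspace R n -> C) (T : cspace R m -> cspace R n) p :
  (forall j, csmooth (fun q => zc (T q) j) p) -> csmooth g (T p) ->
  csmooth (g \o T) p.
Proof.
move=> sT /csmoothP[V [Vo VTp Vg]].
have [dT _] := differentiable_comp_coord (fun j => csmooth_cdiff (sT j)).
have TV : nbhs p (T @^-1` V).
  by apply: (differentiable_continuous dT); apply: open_nbhs_nbhs.
have [U [Uo Up UV US]] := csmooth_open (enum 'I_n) sT TV.
apply: (csmooth_expr Uo Up).
suff UT j : smooth_expr U (fun q => zc (T q) j).
  exact: (@SmoothComp R m U n V T g UV UT Vg).
apply: SmoothBase; apply: US.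
move: (mem_enum 'I_n j); elim: (enum 'I_n) => //= a l IH.
by rewrite inE => /orP[/eqP->|/IH]; [left|right].
Qed.

Lemma csmooth_cst m (c : C) (p : cspace R m) : csmooth (fun=> c) p.
Proof. by apply: (@csmooth_expr _ setT); [exact: openT| |exact: SmoothCst]. Qed.

Lemma csmoothD m (f g : cspace R m -> C) p : csmooth f p -> csmooth g p ->
  csmooth (fun q => f q + g q) p.
Proof.
move=> sf sg.
have [|U [Uo Up _ US]] := @csmooth_open _ bool (fun b => if b then f else g)
    p setT [:: true; false] _ filterT.
  by case.
apply: (csmooth_expr Uo Up); apply: SmoothAdd; apply: SmoothBase.
  by apply: (US true); left.
by apply: (US false); right; left.
Qed.

Lemma csmoothM m (f g : cspace R m -> C) p : csmooth f p -> csmooth g p ->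
  csmooth (fun q => f q * g q) p.
Proof.
move=> sf sg.
have [|U [Uo Up _ US]] := @csmooth_open _ bool (fun b => if b then f else g)
    p setT [:: true; false] _ filterT.
  by case.
apply: (csmooth_expr Uo Up); apply: SmoothMul; apply: SmoothBase.
  by apply: (US true); left.
by apply: (US false); right; left.
Qed.

Lemma csmoothJ m (f : cspace R m -> C) p : csmooth f p -> csmooth (fun q => (f q)^*) p.
Proof.
move=> /csmoothP[U [Uo Up Uf]]; apply: (csmooth_expr Uo Up).
exact/SmoothConj/SmoothBase.
Qed.

Lemma csmoothV m (f : cspace R m -> C) p : csmooth f p -> f p != 0 ->
  csmooth (fun q => (f q)^-1) p.
Proof.
move=> sf f0; have f0n := cdiff_neq0_near (csmooth_cdiff sf) f0.
have [U [Uo Up UP US]] := @csmooth_open _ unit (fun=> f) p _ [:: tt] (fun=> sf) f0n.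
apply: (csmooth_expr Uo Up); apply: SmoothInv => //.
by apply/SmoothBase/(US tt); left.
Qed.

(** All derivatives of a coordinate of order at least one are constant. *)
Lemma csmooth_zc m j (p : cspace R m) : csmooth (fun q => zc q j) p.
Proof.
suff H s : exists c : C, (foldr (@dder R m) (fun q => zc q j) s = fun=> c) \/ s = [::].
  rewrite /csmooth; near=> q => s.
  have [c [->|->]] := H s; first exact: cdiff_cst.
  exact: cdiff_zc.
elim: s => [|v s [c IH]]; first by exists 0; right.
case: IH => [IH|->].
  by exists 0; left; rewrite /= IH; apply/funext => q; rewrite dder_cst.
by exists (zc v j); left; apply/funext => q /=; rewrite dder_zc.
Unshelve. all: by end_near. Qed.

Lemma csmooth_dz m j (f : cspace R m -> C) p : csmooth f p -> csmooth (dz j f) p.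
Proof.
move=> sf; rewrite (_ : dz j f =
    fun q => (dder (ex R j) f q + (- 'i%C) * dder (ey R j) f q) * (2%:R)^-1).
  apply: csmoothM; last exact: csmooth_cst.
  apply: csmoothD; first exact: csmooth_dder.
  by apply: csmoothM; [exact: csmooth_cst|exact: csmooth_dder].
by apply/funext => q; rewrite mulNr.
Qed.

Lemma csmooth_dzb m j (f : cspace R m -> C) p : csmooth f p -> csmooth (dzb j f) p.
Proof.
move=> sf; rewrite (_ : dzb j f =
    fun q => (dder (ex R j) f q + 'i%C * dder (ey R j) f q) * (2%:R)^-1) //.
apply: csmoothM; last exact: csmooth_cst.
apply: csmoothD; first exact: csmooth_dder.
by apply: csmoothM; [exact: csmooth_cst|exact: csmooth_dder].
Qed.

Lemma csmooth_sum m (I : finType) (F : I -> cspace R m -> C) p :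
  (forall i, csmooth (F i) p) -> csmooth (fun q => \sum_i F i q) p.
Proof.
move=> sF; elim: (index_enum I) => [|i r IH].
  rewrite (_ : (fun _ => _) = fun=> 0); first exact: csmooth_cst.
  by apply/funext => q; rewrite big_nil.
rewrite (_ : (fun _ => _) = fun q => F i q + \sum_(i <- r) F i q).
  exact: csmoothD.
by apply/funext => q; rewrite big_cons.
Qed.

Lemma wirt_near_eq_comp m n a b (f : cspace R m -> C) (g : cspace R n -> C) T p :
  (\forall q \near p, f q = g (T q)) ->
  (forall j, csmooth (fun q => zc (T q) j) p) -> csmooth g (T p) ->
  wirt a b p f =
  wirt (fun j => wirt a b p (fun q => zc (T q) j))
       (fun j => wirt a b p (fun q => (zc (T q) j)^*)) (T p) g.
Proof.
move=> fg sT sg; rewrite (wirt_eq_near _ _ fg) -wirt_comp //.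
  by move=> j; apply: csmooth_cdiff.
exact: csmooth_cdiff.
Qed.

Lemma cholo_near m (f : cspace R m -> C) p : cholo f p -> \forall q \near p, cholo f q.
Proof.
move=> [/csmooth_near sf /nbhs_interior df].
by apply: filterS2 sf df => q sfq dfq; split.
Qed.

Lemma cholo_eq_near m (f g : cspace R m -> C) p :
  (\forall q \near p, f q = g q) -> cholo f p -> cholo g p.
Proof.
move=> fg [sf df]; split; first exact: csmooth_eq_near fg sf.
apply: filterS2 (nbhs_interior fg) df => q fgq dfq j.
by rewrite -(dfq j) !dzb_wirt; apply/esym/wirt_eq_near.
Qed.

Lemma cholo_zc m j (p : cspace R m) : cholo (fun q => zc q j) p.
Proof.
split; first exact: csmooth_zc.
by near=> q => k; rewrite dzb_zc.
Unshelve. all: by end_near. Qed.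

Lemma wirt_cholo m a b (f : cspace R m -> C) p : cholo f p ->
  wirt a b p f = \sum_j a j * dz j f p.
Proof.
by move=> [_ /nbhs_singleton df]; apply: eq_bigr => j _; rewrite df mulr0 addr0.
Qed.

(** In the chain rule for d/d(conj z^j), the terms with d/dz of [g] carry the factor dzb of a
    coordinate of [T], and the others carry dzb of [g]; both vanish at all points near [p]. *)
Lemma cholo_comp m n (g : cspace R n -> C) (T : cspace R m -> cspace R n) p :
  (forall j, cholo (fun q => zc (T q) j) p) -> cholo g (T p) -> cholo (g \o T) p.
Proof.
move=> hT hg; have sT j := (hT j).1.
split; first exact: csmooth_comp sT hg.1.
have [dT _] := differentiable_comp_coord (fun j => csmooth_cdiff (sT j)).
have Tg : \forall q \near p, cholo g (T q).
  suff: nbhs p (T @^-1` [set q | cholo g q]) by [].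
  by apply: (differentiable_continuous dT); apply: cholo_near.
have hTn : \forall q \near p, forall j, cholo (fun q => zc (T q) j) q.
  apply: (@filter_forall _ _ (fun j => [set q | cholo (fun q => zc (T q) j) q])
    _ (nbhs_filter p)) => j.
  exact: cholo_near (hT j).
near=> q => j.
have gq : cholo g (T q) by near: q.
have Tq k : cholo (fun q => zc (T q) k) q by move: k; near: q.
rewrite dzb_wirt wirt_comp; first last.
- exact: csmooth_cdiff gq.1.
- by move=> k; apply: csmooth_cdiff (Tq k).1.
rewrite wirt_cholo // big1 // => k _.
by rewrite -dzb_wirt (nbhs_singleton (Tq k).2) mul0r.
Unshelve. all: by end_near. Qed.

End SmoothAt.

(** * Complex manifolds *)

(* Restores [coord] and [cst], shadowed by the libraries. *)
Import Pilot.Defs.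

Section Charts.
Variables (R : realType) (T : topologicalType) (n : nat).
Local Notation C := R[i].
Implicit Types (phi psi : chart R T n) (x : T).

Lemma near_cdom phi x : cdom phi x -> \forall y \near x, cdom phi y.
Proof. by move=> px; apply: open_nbhs_nbhs; split=> //; apply: cdom_open. Qed.

Lemma near_ccod phi x : cdom phi x ->
  \forall q \near fwd phi x, cdom phi (bwd phi q) /\ fwd phi (bwd phi q) = q.
Proof.
move=> px; apply: filterS (open_nbhs_nbhs _); last first.
  by split; [exact: (ccod_open (c := phi)) | exists x].
by move=> _ [y py <-]; rewrite fwdK.
Qed.

Lemma near_fwd phi x (P : set (cspace R n)) : cdom phi x ->
  (\forall q \near fwd phi x, P q) -> \forall y \near x, P (fwd phi y).
Proof. by move=> px; apply: fwd_cont. Qed.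

Lemma near_bwd phi x (P : set T) : cdom phi x ->
  (\forall y \near x, P y) -> \forall q \near fwd phi x, P (bwd phi q).
Proof.
by move=> px Px; apply: (bwd_cont (imageP _ px)); rewrite fwdK.
Qed.

Lemma near_transition (f : T -> C) phi psi x : cdom phi x -> cdom psi x ->
  \forall q \near fwd psi x,
    (f \o bwd psi) q = (f \o bwd phi) ((fwd phi \o bwd psi) q).
Proof.
move=> px qx; have := near_bwd qx (near_cdom px).
by apply: filterS => q pq /=; rewrite fwdK.
Qed.

Lemma csmooth_transition (f : T -> C) phi psi x :
  transition_holo psi phi -> cdom phi x -> cdom psi x ->
  csmooth (f \o bwd phi) (fwd phi x) -> csmooth (f \o bwd psi) (fwd psi x).
Proof.
move=> pp px qx sf.
have tE := near_transition f px qx.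
apply: csmooth_eq_near; first by apply: filterS tE => q ->.
apply: csmooth_comp => [j|]; first exact: (pp _ qx px j).1.
by rewrite /= fwdK.
Qed.

Lemma cholo_transition (f : T -> C) phi psi x :
  transition_holo psi phi -> cdom phi x -> cdom psi x ->
  cholo (f \o bwd phi) (fwd phi x) -> cholo (f \o bwd psi) (fwd psi x).
Proof.
move=> pp px qx sf.
have tE := near_transition f px qx.
apply: cholo_eq_near; first by apply: filterS tE => q ->.
apply: cholo_comp => [j|]; first exact: (pp _ qx px j).
by rewrite /= fwdK.
Qed.

End Charts.

Section SmoothManifold.
Variables (R : realType) (n : nat) (M : cmanifold R n).
Local Notation C := R[i].
Implicit Types (x y : M) (f g : M -> C) (chi phi : chart R M n).

Lemma atlas_holo_chart phi : atlas phi -> holo_chart phi.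
Proof. by move=> ap psi aq; split; apply: atlas_compat. Qed.

(** The definition tests smoothness in some chart of the atlas; compatibility in both directions
    lets any chart of the maximal atlas do it, which adapted charts require. *)
Lemma smooth_nearP chi f x : holo_chart chi -> cdom chi x ->
  smooth_near f x <-> csmooth (f \o bwd chi) (fwd chi x).
Proof.
move=> hchi cx; split=> [[phi [ap px]]|sf].
  by apply: csmooth_transition => //; have [] := hchi _ ap.
have [phi ap px] := atlas_cover x; exists phi; split=> [//|//|].
by apply: csmooth_transition sf => //; have [] := hchi _ ap.
Qed.

Lemma holo_nearP chi f x : holo_chart chi -> cdom chi x ->
  holo_near f x <-> cholo (f \o bwd chi) (fwd chi x).
Proof.
move=> hchi cx; split=> [[phi [ap px]]|sf].
  by apply: cholo_transition => //; have [] := hchi _ ap.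
have [phi ap px] := atlas_cover x; exists phi; split=> [//|//|].
by apply: cholo_transition sf => //; have [] := hchi _ ap.
Qed.

Lemma holo_smooth f x : holo_near f x -> smooth_near f x.
Proof. by move=> [phi [ap px [sf _]]]; exists phi. Qed.

Lemma coord_holo chi j x : holo_chart chi -> cdom chi x -> holo_near (coord chi j) x.
Proof.
move=> hchi cx; apply/(holo_nearP _ hchi cx).
apply: cholo_eq_near (cholo_zc j (fwd chi x)).
by apply: filterS (near_ccod cx) => q [_]; rewrite /coord /= => ->.
Qed.

Lemma coord_smooth chi j x : holo_chart chi -> cdom chi x -> smooth_near (coord chi j) x.
Proof. by move=> hchi cx; apply/holo_smooth/coord_holo. Qed.

Lemma eq_near_bwd chi f g x : cdom chi x -> (\forall y \near x, f y = g y) ->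
  \forall q \near fwd chi x, (f \o bwd chi) q = (g \o bwd chi) q.
Proof. by move=> cx fg; apply: near_bwd cx fg. Qed.

Lemma smooth_near_eq f g x : (\forall y \near x, f y = g y) ->
  smooth_near f x -> smooth_near g x.
Proof.
move=> fg [phi [ap px sf]]; exists phi; split=> [//|//|].
exact: csmooth_eq_near (eq_near_bwd px fg) sf.
Qed.

Lemma smooth_near_near f x : smooth_near f x -> \forall y \near x, smooth_near f y.
Proof.
move=> [phi [ap px sf]].
apply: filterS2 (near_cdom px) (near_fwd px (csmooth_near sf)) => y py sfy.
by exists phi.
Qed.

Lemma smooth_near_cst (c : C) x : smooth_near (fun=> c : C) x.
Proof.
by have [phi ap px] := atlas_cover x; exists phi; split=> [//|//|]; exact: csmooth_cst.
Qed.

Lemma smooth_nearD f g x : smooth_near f x -> smooth_near g x ->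
  smooth_near (fun y => f y + g y) x.
Proof.
move=> [phi [ap px sf]] /(smooth_nearP _ (atlas_holo_chart ap) px) sg.
by exists phi; split=> [//|//|]; exact: csmoothD sf sg.
Qed.

Lemma smooth_nearM f g x : smooth_near f x -> smooth_near g x ->
  smooth_near (fun y => f y * g y) x.
Proof.
move=> [phi [ap px sf]] /(smooth_nearP _ (atlas_holo_chart ap) px) sg.
by exists phi; split=> [//|//|]; exact: csmoothM sf sg.
Qed.

Lemma smooth_nearJ f x : smooth_near f x -> smooth_near (cconj f) x.
Proof.
by move=> [phi [ap px sf]]; exists phi; split=> [//|//|]; exact: csmoothJ sf.
Qed.

Lemma smooth_nearV f x : smooth_near f x -> f x != 0 ->
  smooth_near (fun y => (f y)^-1) x.
Proof.
move=> [phi [ap px sf]] fx0; exists phi; split=> [//|//|].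
by apply: csmoothV sf _; rewrite /= fwdK.
Qed.

Lemma smooth_near_sum (I : finType) (F : I -> M -> C) x :
  (forall i, smooth_near (F i) x) -> smooth_near (fun y => \sum_i F i y) x.
Proof.
move=> sF; have [phi ap px] := atlas_cover x; exists phi; split=> [//|//|].
apply: (@csmooth_sum R n I (fun i => F i \o bwd phi)) => i.
exact/(smooth_nearP _ (atlas_holo_chart ap) px).
Qed.

Lemma smooth_near_comp k (g : cspace R k -> C) (T : M -> cspace R k) x :
  (forall j, smooth_near (fun y => zc (T y) j) x) -> csmooth g (T x) ->
  smooth_near (g \o T) x.
Proof.
move=> sT sg; have [phi ap px] := atlas_cover x; exists phi; split=> [//|//|].
apply: (@csmooth_comp R n k g (T \o bwd phi)); last by rewrite /= fwdK.
by move=> j; apply/(smooth_nearP (fun y => zc (T y) j) (atlas_holo_chart ap) px).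
Qed.

Lemma smooth_near_neq0 f x : smooth_near f x -> f x != 0 -> \forall y \near x, f y != 0.
Proof.
move=> [phi [ap px sf]] fx0.
have /near_fwd : \forall q \near fwd phi x, (f \o bwd phi) q != 0.
  by apply: (cdiff_neq0_near (csmooth_cdiff sf)); rewrite /= fwdK.
by move=> /(_ px); apply: filterS2 (near_cdom px) => y py; rewrite /= fwdK.
Qed.

End SmoothManifold.

#[local] Opaque smooth_near holo_near csmooth cholo.

(** * Tangent vectors as derivations *)

Section Tangent.
Variables (R : realType) (n : nat) (M : cmanifold R n).
Local Notation C := R[i].
Implicit Types (x y : M) (f g : M -> C) (chi phi : chart R M n) (u v w : vec M).

(** Normal form of a tangent vector in the chart [chi], with the default value 0 that [tangent]
    prescribes. *)
Definition tvec chi (a b : 'I_n -> C) x : vec M := fun f =>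
  if `[< smooth_near f x >] then wirt a b (fwd chi x) (f \o bwd chi) else 0.

Lemma tvecE chi a b x f : smooth_near f x ->
  tvec chi a b x f = wirt a b (fwd chi x) (f \o bwd chi).
Proof. by move=> sf; rewrite /tvec asboolT. Qed.

Lemma tangent_tvec_atlas x v : tangent x v ->
  exists phi, [/\ atlas phi, cdom phi x & exists a b, v = tvec phi a b x].
Proof.
move=> [phi [ap px [a [b vE]]]]; exists phi; split=> [//|//|].
by exists a, b; apply/funext => f; rewrite vE.
Qed.

Lemma tangent_junk x v f : tangent x v -> ~ smooth_near f x -> v f = 0.
Proof. by move=> [phi [_ _ [a [b ->]]]] nf; rewrite asboolF. Qed.

(** Common source of the components in another chart ([tangentE]) and of the coordinate form of a
    pushforward ([pushforwardE]). *)
Lemma tangent_comp k x v f (g : cspace R k -> C) (T : M -> cspace R k) :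
  tangent x v -> (\forall y \near x, f y = g (T y)) ->
  (forall j, smooth_near (fun y => zc (T y) j) x) -> csmooth g (T x) ->
  v f = wirt (fun j => v (fun y => zc (T y) j))
             (fun j => v (fun y => (zc (T y) j)^*)) (T x) g.
Proof.
move=> /tangent_tvec_atlas[phi [ap px [a [b ->]]]] fgT sT sg.
have hp := atlas_holo_chart ap.
have sf : smooth_near f x.
  apply: smooth_near_eq (smooth_near_comp sT sg).
  by apply: filterS fgT => y ->.
rewrite tvecE // (@wirt_near_eq_comp _ _ _ _ _ _ g (T \o bwd phi)); first last.
- by rewrite /= fwdK.
- by move=> j; apply/(smooth_nearP (fun y => zc (T y) j) hp px).
- exact: near_bwd px fgT.
rewrite /= fwdK //; congr (wirt _ _ _ _); apply/funext => j; rewrite tvecE //.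
exact: smooth_nearJ.
Qed.

(** [tangent] yields components in some chart of the atlas only; in any holomorphic chart they are
    recovered as values on the coordinates and their conjugates. *)
Lemma tangentE chi x v : holo_chart chi -> cdom chi x -> tangent x v ->
  v = tvec chi (fun j => v (coord chi j)) (fun j => v (cconj (coord chi j))) x.
Proof.
move=> hchi cx tv; apply/funext => f.
have [sf|nf] := pselect (smooth_near f x); last first.
  by rewrite (tangent_junk tv nf) /tvec asboolF.
rewrite tvecE // (@tangent_comp n x v f (f \o bwd chi) (fwd chi)) //.
- by apply: filterS (near_cdom cx) => y cy; rewrite /= fwdK.
- by move=> j; exact: coord_smooth.
- exact/smooth_nearP.
Qed.

Lemma tangent_ext chi x u v : holo_chart chi -> cdom chi x -> tangent x u -> tangent x v ->
  (forall j, u (coord chi j) = v (coord chi j)) ->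
  (forall j, u (cconj (coord chi j)) = v (cconj (coord chi j))) -> u = v.
Proof.
move=> hchi cx tu tv e1 e2; rewrite (tangentE hchi cx tu) (tangentE hchi cx tv).
by congr (tvec _ _ _ _); apply/funext.
Qed.

(** Smoothness near [x] is itself local, so for non-smooth functions both sides take the default
    value together. *)
Lemma tangent_eq_near x v f g : tangent x v -> (\forall y \near x, f y = g y) -> v f = v g.
Proof.
move=> /tangent_tvec_atlas[phi [ap px [a [b ->]]]] fg.
have [sf|nf] := pselect (smooth_near f x); last first.
  rewrite /tvec !asboolF // => sg; apply: nf; apply: smooth_near_eq sg.
  by apply: filterS fg => y ->.
rewrite (tvecE _ _ _ sf) (tvecE _ _ _ (smooth_near_eq fg sf)).
by apply: wirt_eq_near; apply: near_bwd px fg.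
Qed.

Lemma tangent_cst x v (c : C) : tangent x v -> v (fun=> c) = 0.
Proof.
move=> /tangent_tvec_atlas[phi [ap px [a [b ->]]]].
by rewrite tvecE; [exact: wirt_cst | exact: smooth_near_cst].
Qed.

Lemma tangentM x v f g : tangent x v -> smooth_near f x -> smooth_near g x ->
  v (fun y => f y * g y) = f x * v g + g x * v f.
Proof.
move=> /tangent_tvec_atlas[phi [ap px [a [b ->]]]] sf sg.
have hp := atlas_holo_chart ap.
rewrite !tvecE //; last exact: smooth_nearM.
rewrite (_ : (fun y => _) \o _ = fun q => (f \o bwd phi) q * (g \o bwd phi) q) //.
rewrite wirtM; [by rewrite /= fwdK|by apply/csmooth_cdiff/smooth_nearP..].
Qed.

Lemma tangentZ x v (c : C) f : tangent x v -> smooth_near f x ->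
  v (fun y => c * f y) = c * v f.
Proof.
move=> tv sf; rewrite (tangentM tv) //; last exact: smooth_near_cst.
by rewrite (tangent_cst _ tv) mulr0 addr0.
Qed.

Lemma tangentV x v f : tangent x v -> smooth_near f x -> f x != 0 ->
  v (fun y => (f y)^-1) = - (f x)^-1 * (f x)^-1 * v f.
Proof.
move=> tv sf f0; have sV := smooth_nearV sf f0.
have := tangentM tv sf sV.
rewrite (tangent_eq_near (g := fun=> 1) tv); last first.
  by apply: filterS (smooth_near_neq0 sf f0) => y y0; rewrite divff.
rewrite (tangent_cst _ tv) => /eqP; rewrite eq_sym addr_eq0 => /eqP h.
by apply: (mulfI f0); rewrite h; field.
Qed.

Lemma tangent_tvec chi a b x : holo_chart chi -> cdom chi x -> tangent x (tvec chi a b x).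
Proof.
move=> hchi cx; have [phi ap px] := atlas_cover x; exists phi; split=> [//|//|].
have hp := atlas_holo_chart ap.
pose L f := wirt a b (fwd chi x) (f \o bwd chi).
(* The components in the atlas chart are the values on its coordinates, as the chain rule for the
   transition map dictates. *)
exists (fun j => L (coord phi j)), (fun j => L (cconj (coord phi j))) => f.
case: ifPn => [/asboolP sf|/asboolP nf]; last by rewrite /tvec asboolF.
rewrite tvecE // (@wirt_near_eq_comp _ _ _ _ _ _ (f \o bwd phi) (fwd phi \o bwd chi)).
- by rewrite /= fwdK.
- by apply: near_transition.
- by move=> j; apply/(smooth_nearP (coord phi j) hchi cx); exact: coord_smooth.
- by rewrite /= fwdK //; apply/smooth_nearP.
Qed.

Lemma tvec_coord chi a b x j : holo_chart chi -> cdom chi x ->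
  tvec chi a b x (coord chi j) = a j /\ tvec chi a b x (cconj (coord chi j)) = b j.
Proof.
move=> hchi cx; have sc := coord_smooth j hchi cx.
have cE : \forall q \near fwd chi x, (coord chi j \o bwd chi) q = zc q j.
  by apply: filterS (near_ccod cx) => q [_]; rewrite /coord /= => ->.
rewrite !tvecE //; last exact: smooth_nearJ.
rewrite (wirt_eq_near _ _ cE) wirt_zc; split=> //.
rewrite (@wirt_eq_near _ _ _ _ _ (fun q => (zc q j)^*)) ?wirt_zcJ //.
by apply: filterS cE => q; rewrite /= /cconj => ->.
Qed.

Lemma tangent_vlin x (a : C) u v : tangent x u -> tangent x v -> tangent x (vlin a u v).
Proof.
move=> tu tv; have [phi ap px] := atlas_cover x.
have hp := atlas_holo_chart ap; rewrite (tangentE hp px tu) (tangentE hp px tv).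
set a1 := fun j => u _; set b1 := fun j => u _; set a2 := fun j => v _; set b2 := fun j => v _.
suff -> : vlin a (tvec phi a1 b1 x) (tvec phi a2 b2 x) =
    tvec phi (fun j => a * a1 j + a2 j) (fun j => a * b1 j + b2 j) x by exact: tangent_tvec.
apply/funext => f; rewrite /vlin /tvec; case: ifP => _; first by rewrite wirt_lin.
by rewrite mulr0 addr0.
Qed.

Lemma tangent0 x : tangent x (fun=> 0).
Proof.
have [phi ap px] := atlas_cover x; exists phi; split=> [//|//|].
exists (fun=> 0), (fun=> 0) => f; case: ifP => // _.
by rewrite big1 // => j _; rewrite !mul0r addr0.
Qed.

Lemma cconjK f : cconj (cconj f) = f.
Proof. by apply/funext => y; rewrite /cconj conjCK. Qed.

Lemma smooth_near_cconj f x : smooth_near (cconj f) x <-> smooth_near f x.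
Proof. by split=> /smooth_nearJ; rewrite ?cconjK. Qed.

Lemma tangent_vconj x v : tangent x v -> tangent x (vconj v).
Proof.
move=> tv; have [phi ap px] := atlas_cover x.
have hp := atlas_holo_chart ap; rewrite (tangentE hp px tv).
set a := fun j => v _; set b := fun j => v _.
suff -> : vconj (tvec phi a b x) = tvec phi (fun j => (b j)^*) (fun j => (a j)^*) x.
  exact: tangent_tvec.
apply/funext => f; rewrite /vconj.
have [sf|nf] := pselect (smooth_near f x); last first.
  by rewrite /tvec !asboolF ?conjC0 // => /smooth_near_cconj.
rewrite !tvecE //; last exact: smooth_nearJ.
rewrite [wirt a b _ _](@wirtJ R n a b (f \o bwd phi)) ?conjCK //.
exact/csmooth_cdiff/smooth_nearP.
Qed.

Lemma vconjK v : vconj (vconj v) = v.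
Proof. by apply/funext => f; rewrite /vconj cconjK conjCK. Qed.

End Tangent.

(** * The complex structure and the type of a vector *)

Section ComplexStructure.
Variables (R : realType) (n : nat) (M : cmanifold R n).
Local Notation C := R[i].
Implicit Types (x y : M) (f g : M -> C) (chi phi : chart R M n) (u v w : vec M).

Definition vscale (c : C) v : vec M := fun f => c * v f.

Lemma vscaleE (c : C) v : vscale c v = vlin c v (fun=> 0).
Proof. by apply/funext => f; rewrite /vlin addr0. Qed.

Lemma tangent_vscale x (c : C) v : tangent x v -> tangent x (vscale c v).
Proof. by move=> tv; rewrite vscaleE; apply: tangent_vlin => //; exact: tangent0. Qed.

(** The condition under which [xget] chooses in the definition of [J], named to separate existence
    from uniqueness. *)
Definition J_like x v w := tangent x w /\ forall f, holo_near f x ->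
  w f = 'i%C * v f /\ w (cconj f) = - 'i%C * v (cconj f).

Lemma J_exists x v : tangent x v -> exists w, J_like x v w.
Proof.
move=> /tangent_tvec_atlas[phi [ap px [a [b ->]]]].
have hp := atlas_holo_chart ap.
(* A holomorphic function sees only the components [a], and its conjugate only the components
   [b]. *)
exists (tvec phi (fun j => 'i%C * a j) (fun j => - 'i%C * b j) x).
split=> [|f hf]; first exact: tangent_tvec.
have sf := holo_smooth hf; have sJ := smooth_nearJ sf.
have hF := (holo_nearP f hp px).1 hf.
rewrite (tvecE _ _ _ sf) (tvecE _ _ _ sf) (tvecE _ _ _ sJ) (tvecE _ _ _ sJ).
have cF := csmooth_cdiff ((smooth_nearP f hp px).1 sf).
have EJ a' b' : wirt a' b' (fwd phi x) (cconj f \o bwd phi) =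
    (wirt (fun j => (b' j)^*) (fun j => (a' j)^*) (fwd phi x) (f \o bwd phi))^*.
  exact: wirtJ.
have cc (z w : C) : (z^* * w)^* = z * w^* by rewrite rmorphM /= conjCK.
rewrite !EJ !wirt_cholo //; split.
  by rewrite mulr_sumr; apply: eq_bigr => j _; rewrite mulrA.
rewrite !rmorph_sum mulr_sumr; apply: eq_bigr => j _.
by rewrite /= !cc mulrA.
Qed.

(** Coordinates are holomorphic, so the condition already prescribes all components of [w]. *)
Lemma J_unique x v w : J_like x v w -> J x v = w.
Proof.
move=> Jw; have Jv : J_like x v (J x v) by exact: (xgetPex _ (ex_intro _ w Jw)).
have [phi ap px] := atlas_cover x; have hp := atlas_holo_chart ap.
have [tw ww] := Jw; have [tJ JJ] := Jv.
by apply: (tangent_ext hp px) => // j; have hc := coord_holo j hp px;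
   have [e1 e2] := ww _ hc; have [e3 e4] := JJ _ hc; rewrite ?e3 ?e4 ?e1 ?e2.
Qed.

Lemma JP x v : tangent x v -> J_like x v (J x v).
Proof. by move=> /J_exists[w Jw]; rewrite (J_unique Jw). Qed.

Lemma tangent_J x v : tangent x v -> tangent x (J x v).
Proof. by move=> /JP[]. Qed.

Lemma J_holo x v f : tangent x v -> holo_near f x -> J x v f = 'i%C * v f.
Proof. by move=> /JP[_ JJ] /JJ[]. Qed.

Lemma J_conj_holo x v f : tangent x v -> holo_near f x ->
  J x v (cconj f) = - 'i%C * v (cconj f).
Proof. by move=> /JP[_ JJ] /JJ[]. Qed.

Lemma J_vlin x (a : C) u v : tangent x u -> tangent x v ->
  J x (vlin a u v) = vlin a (J x u) (J x v).
Proof.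
move=> tu tv; apply: J_unique; split.
  by apply: tangent_vlin; exact: tangent_J.
move=> f hf; rewrite /vlin.
rewrite (J_holo tu hf) (J_holo tv hf) (J_conj_holo tu hf) (J_conj_holo tv hf).
by split; rewrite mulrDr !mulrA [_ * a]mulrC.
Qed.

Lemma J10_coord chi x v : holo_chart chi -> cdom chi x -> tangent x v ->
  (forall j, v (cconj (coord chi j)) = 0) -> J x v = vscale 'i%C v.
Proof.
move=> hchi cx tv v0; apply: (tangent_ext hchi cx) => [||j|j].
- exact: tangent_J.
- exact: tangent_vscale.
- by rewrite J_holo //; exact: coord_holo.
- by rewrite J_conj_holo ?/vscale ?v0 ?mulr0 //; exact: coord_holo.
Qed.

Lemma J01_coord chi x v : holo_chart chi -> cdom chi x -> tangent x v ->
  (forall j, v (coord chi j) = 0) -> J x v = vscale (- 'i%C) v.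
Proof.
move=> hchi cx tv v0; apply: (tangent_ext hchi cx) => [||j|j].
- exact: tangent_J.
- exact: tangent_vscale.
- by rewrite J_holo ?/vscale ?v0 ?mulr0 //; exact: coord_holo.
- by rewrite J_conj_holo //; exact: coord_holo.
Qed.

Lemma i_neq0 : ('i%C : C) != 0.
Proof. by rewrite eq_complex /= oner_eq0 andbF. Qed.

Lemma i_eq_opp (z : C) : 'i%C * z = - 'i%C * z -> z = 0.
Proof.
move=> /eqP; rewrite mulNr -addr_eq0 -mulr2n mulrn_eq0 /= mulf_eq0 (negbTE i_neq0).
by move/eqP.
Qed.

(** On the conjugate of a holomorphic function, [J x v] is -i times [v] by construction and i times
    [v] by type. *)
Lemma tangent10_conj x v f : tangent10 x v -> holo_near f x -> v (cconj f) = 0.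
Proof.
move=> [tv Jv] hf; apply: i_eq_opp.
by rewrite -(J_conj_holo tv hf) Jv.
Qed.

Lemma J_vconj10 x v : tangent10 x v -> J x (vconj v) = vscale (- 'i%C) (vconj v).
Proof.
move=> tv; have [phi ap px] := atlas_cover x; have hp := atlas_holo_chart ap.
apply: (J01_coord hp px); first exact: tangent_vconj tv.1.
by move=> j; rewrite /vconj (tangent10_conj tv) ?conjC0 //; exact: coord_holo.
Qed.

Lemma pi10_id x v : tangent10 x v -> pi10 x v = v.
Proof.
move=> [tv Jv]; apply/funext => f; rewrite /pi10 Jv mulrA sqi mulN1r opprK.
by rewrite -mulr2n -[v f *+ 2]mulr_natr mulfK ?two_neq0.
Qed.

Lemma pi10E x v : pi10 x v = vlin (2%:R^-1) v (vscale (- 'i%C / 2%:R) (J x v)).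
Proof. by apply/funext => f; rewrite /pi10 /vlin /vscale; ring. Qed.

Lemma tangent_pi10 x v : tangent x v -> tangent x (pi10 x v).
Proof.
move=> tv; rewrite pi10E; apply: tangent_vlin => //.
exact/tangent_vscale/tangent_J.
Qed.

Lemma J_pi10 x v : tangent x v -> J x (pi10 x v) = vscale 'i%C (pi10 x v).
Proof.
move=> tv; have [phi ap px] := atlas_cover x; have hp := atlas_holo_chart ap.
apply: (J10_coord hp px); first exact: tangent_pi10.
move=> j; rewrite /pi10 J_conj_holo //; last exact: coord_holo.
by rewrite mulrA mulrN sqi opprK mul1r subrr mul0r.
Qed.

End ComplexStructure.

Section VectorFields.
Variables (R : realType) (n : nat) (M : cmanifold R n).
Local Notation C := R[i].
Implicit Types (x y : M) (f g h : M -> C) (chi phi : chart R M n) (X Y : vfield M).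

Lemma smooth_near_wirt chi x f (a b : 'I_n -> M -> C) :
  holo_chart chi -> cdom chi x -> smooth_near f x ->
  (forall j, smooth_near (a j) x) -> (forall j, smooth_near (b j) x) ->
  smooth_near (fun y => wirt (a^~ y) (b^~ y) (fwd chi y) (f \o bwd chi)) x.
Proof.
move=> hchi cx sf sa sb.
have sc j : smooth_near (fun y => zc (fwd chi y) j) x by exact: coord_smooth.
have sF := (smooth_nearP f hchi cx).1 sf.
apply: smooth_near_sum => j; apply: smooth_nearD; apply: smooth_nearM => //.
  exact: (smooth_near_comp sc (csmooth_dz j sF)).
exact: (smooth_near_comp sc (csmooth_dzb j sF)).
Qed.

(** The test for fields that are defined point by point, such as [fJ X] and the horizontal lift. *)
Lemma is_vfield_coord X : (forall x, tangent x (X x)) ->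
  (forall x, exists chi, [/\ holo_chart chi, cdom chi x,
     forall j, smooth_near (fun y => X y (coord chi j)) x &
     forall j, smooth_near (fun y => X y (cconj (coord chi j))) x]) ->
  is_vfield X.
Proof.
move=> tX sX; split=> // f x sf; have [chi [hchi cx sa sb]] := sX x.
apply: smooth_near_eq (smooth_near_wirt hchi cx sf sa sb).
apply: filterS2 (near_cdom cx) (smooth_near_near sf) => y cy sfy.
by rewrite [in RHS](tangentE hchi cy (tX y)) tvecE.
Qed.

Lemma smooth_cst (c : C) : smooth ((fun=> c) : M -> C).
Proof. by move=> x; apply: smooth_near_cst. Qed.

Lemma vfield_smooth X f x : is_vfield X -> smooth_near f x ->
  smooth_near (fun y => X y f) x.
Proof. by move=> [_]; apply. Qed.

Lemma vfield_flin h X Y : smooth h -> is_vfield X -> is_vfield Y -> is_vfield (flin h X Y).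
Proof.
move=> sh vX vY; split=> [x|f x sf]; first by apply: tangent_vlin; [exact: vX.1|exact: vY.1].
by apply: smooth_nearD; [apply: smooth_nearM|]; [exact: sh|exact: vfield_smooth..].
Qed.

Lemma vfield0 : is_vfield (fun=> (fun=> 0) : vec M).
Proof. by split=> [x|f x _]; [exact: tangent0|exact: smooth_near_cst]. Qed.

Definition fscale (c : C) X : vfield M := fun x => vscale c (X x).

Lemma fscaleE c X : fscale c X = flin (fun=> c) X (fun=> (fun=> 0)).
Proof. by apply/funext => x; rewrite /fscale vscaleE. Qed.

Lemma vfield_fconj X : is_vfield X -> is_vfield (fconj X).
Proof.
move=> vX; split=> [x|f x sf]; first exact: tangent_vconj (vX.1 x).
apply: (@smooth_nearJ _ _ _ (fun y => X y (cconj f))).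
exact/(vfield_smooth vX)/smooth_nearJ.
Qed.

Lemma vfield_fJ X : is_vfield X -> is_vfield (fJ X).
Proof.
move=> vX; apply: is_vfield_coord => x; first exact: tangent_J (vX.1 x).
have [phi ap px] := atlas_cover x; have hp := atlas_holo_chart ap.
exists phi; split=> // j; have sc := coord_smooth j hp px.
  apply: (@smooth_near_eq _ _ _ (fun y => 'i%C * X y (coord phi j))).
    apply: filterS (near_cdom px) => y py; rewrite /fJ J_holo //; first exact: vX.1.
    exact: coord_holo.
  by apply: smooth_nearM; [exact: smooth_near_cst|exact: vfield_smooth].
apply: (@smooth_near_eq _ _ _ (fun y => - 'i%C * X y (cconj (coord phi j)))).
  apply: filterS (near_cdom px) => y py; rewrite /fJ J_conj_holo //; first exact: vX.1.
  exact: coord_holo.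
apply: smooth_nearM; [exact: smooth_near_cst|apply: vfield_smooth => //].
exact: smooth_nearJ.
Qed.

Lemma fsubE X Y : fsub X Y = flin (fun=> -1) Y X.
Proof. by apply/funext => x; apply/funext => f; rewrite /flin /vlin mulN1r addrC. Qed.

Lemma vfield_fsub X Y : is_vfield X -> is_vfield Y -> is_vfield (fsub X Y).
Proof. by move=> vX vY; rewrite fsubE; apply: vfield_flin => //; exact: smooth_cst. Qed.

Lemma fconjK X : fconj (fconj X) = X.
Proof. by apply/funext => x; rewrite /fconj vconjK. Qed.

Lemma bracketE X Y x f : smooth_near f x ->
  bracket X Y x f = X x (fun y => Y y f) - Y x (fun y => X y f).
Proof. by move=> sf; rewrite /bracket asboolT. Qed.

Lemma fJ10 X : is_vfield10 X -> fJ X = fscale 'i%C X.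
Proof. by move=> [_ X10]; apply/funext => x; rewrite /fJ (X10 x).2. Qed.

Lemma fJ_fconj10 X : is_vfield10 X -> fJ (fconj X) = fscale (- 'i%C) (fconj X).
Proof. by move=> [_ X10]; apply/funext => x; rewrite /fJ J_vconj10. Qed.

Lemma fpi10_id X : is_vfield10 X -> fpi10 X = X.
Proof. by move=> [_ X10]; apply/funext => x; rewrite /fpi10 pi10_id. Qed.

Lemma vfield10_flin h X Y : smooth h -> is_vfield10 X -> is_vfield10 Y ->
  is_vfield10 (flin h X Y).
Proof.
move=> sh [vX X10] [vY Y10]; split; first exact: vfield_flin.
move=> x; have [tX JX] := X10 x; have [tY JY] := Y10 x; split.
  exact: tangent_vlin.
rewrite J_vlin // JX JY; apply/funext => f; rewrite /flin /vlin; ring.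
Qed.

End VectorFields.

(** * Special Kaehler manifolds *)

#[local] Opaque tangent.

Section SpecialKahler.
Variables (R : realType) (n : nat) (M : cmanifold R n) (S : special_kahler M).
Local Notation C := R[i].
Implicit Types (x y : M) (f g h : M -> C) (X Y Z V W : vfield M) (u v w : vec M).
Local Notation nab := (nabla S).

Definition kform x u v : C := metric S x u (J x v).

Lemma PhiE X Y x : Phi S X Y x = kform x (X x) (Y x). Proof. by []. Qed.

Lemma kform_linl x a u v w : tangent x u -> tangent x v -> tangent x w ->
  kform x (vlin a u v) w = a * kform x u w + kform x v w.
Proof. by move=> tu tv tw; apply: metric_lin => //; exact: tangent_J. Qed.

Lemma kform_linr x a u v w : tangent x u -> tangent x v -> tangent x w ->
  kform x w (vlin a u v) = a * kform x w u + kform x w v.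
Proof.
move=> tu tv tw; have tJu := tangent_J tu; have tJv := tangent_J tv.
rewrite /kform J_vlin // (metric_sym S tw); last exact: tangent_vlin.
by rewrite metric_lin // !(metric_sym S tw).
Qed.

Lemma kform0l x w : tangent x w -> kform x (fun=> 0) w = 0.
Proof.
move=> tw; have t0 := tangent0 x.
have := kform_linl 1 t0 t0 tw.
rewrite (_ : vlin 1 _ _ = fun=> 0); last by apply/funext => f; rewrite /vlin mulr0 addr0.
by rewrite mul1r => /esym/(canRL (addrK _)); rewrite subrr.
Qed.

Lemma kform0r x w : tangent x w -> kform x w (fun=> 0) = 0.
Proof.
move=> tw; have t0 := tangent0 x.
have := kform_linr 1 t0 t0 tw.
rewrite (_ : vlin 1 _ _ = fun=> 0); last by apply/funext => f; rewrite /vlin mulr0 addr0.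
by rewrite mul1r => /esym/(canRL (addrK _)); rewrite subrr.
Qed.

Lemma kform_scalel x a u w : tangent x u -> tangent x w ->
  kform x (vscale a u) w = a * kform x u w.
Proof.
by move=> tu tw; rewrite vscaleE kform_linl ?kform0l ?addr0 //; exact: tangent0.
Qed.

Lemma kform_scaler x a u w : tangent x u -> tangent x w ->
  kform x w (vscale a u) = a * kform x w u.
Proof.
by move=> tu tw; rewrite vscaleE kform_linr ?kform0r ?addr0 //; exact: tangent0.
Qed.

Lemma metric_scaler x a u w : tangent x u -> tangent x w ->
  metric S x w (vscale a u) = a * metric S x w u.
Proof.
move=> tu tw; have t0 := tangent0 x.
have m0 : metric S x (fun=> 0) w = 0.
  have := metric_lin S 1 t0 t0 tw.
  rewrite (_ : vlin 1 _ _ = fun=> 0); last by apply/funext => f; rewrite /vlin mulr0 addr0.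
  by rewrite mul1r => /esym/(canRL (addrK _)); rewrite subrr.
rewrite (metric_sym S tw); last exact: tangent_vscale.
by rewrite vscaleE metric_lin // m0 addr0 (metric_sym S tw).
Qed.

Lemma metric_scalel x a u w : tangent x u -> tangent x w ->
  metric S x (vscale a u) w = a * metric S x u w.
Proof.
move=> tu tw; have ts := tangent_vscale a tu.
by rewrite (metric_sym S ts tw) metric_scaler // (metric_sym S tw).
Qed.

(** J-invariance gives g(u, v) = g(iu, iv) = - g(u, v). *)
Lemma kform10 x u v : tangent x u -> tangent x v ->
  J x u = vscale 'i%C u -> J x v = vscale 'i%C v -> kform x u v = 0.
Proof.
move=> tu tv Ju Jv; rewrite /kform Jv metric_scaler //.
have := metric_hermitian S tu tv.
rewrite Ju Jv metric_scaler ?metric_scalel //; last exact: tangent_vscale.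
rewrite mulrA sqi mulN1r => /eqP; rewrite eq_sym -addr_eq0 -mulr2n mulrn_eq0 /= => /eqP ->.
by rewrite mulr0.
Qed.

Lemma nabla_linr h X Y Z x f : smooth h -> is_vfield X -> is_vfield Y -> is_vfield Z ->
  nab X (flin h Y Z) x f = X x h * Y x f + (h x * nab X Y x f + nab X Z x f).
Proof. by move=> sh vX vY vZ; rewrite nabla_leibniz. Qed.

Lemma nabla0r X : is_vfield X -> nab X (fun=> (fun=> 0)) = fun=> (fun=> 0).
Proof.
move=> vX; apply/funext => x; apply/funext => f.
have := @nabla_linr (fun=> 1) X _ _ x f (@smooth_cst _ _ M 1) vX (@vfield0 _ _ M) (@vfield0 _ _ M).
rewrite (_ : flin _ _ _ = fun=> (fun=> 0)); last first.
  by apply/funext => y; apply/funext => g; rewrite /flin /vlin mulr0 addr0.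
by rewrite mulr0 add0r mul1r => /esym/(canRL (addrK _)); rewrite subrr.
Qed.

Lemma nabla0l X : is_vfield X -> nab (fun=> (fun=> 0)) X = fun=> (fun=> 0).
Proof.
move=> vX; apply/funext => x; apply/funext => f.
have := @nabla_linl _ _ _ S (fun=> 1) _ _ X (@smooth_cst _ _ M 1) (@vfield0 _ _ M) (@vfield0 _ _ M) vX.
rewrite (_ : flin _ _ _ = fun=> (fun=> 0)); last first.
  by apply/funext => y; apply/funext => g; rewrite /flin /vlin mulr0 addr0.
move/(congr1 (fun F => F x f)); rewrite /flin /vlin mul1r.
by move=> /esym/(canRL (addrK _)); rewrite subrr.
Qed.

Lemma nabla_fscale c X Y : is_vfield X -> is_vfield Y ->
  nab X (fscale c Y) = fscale c (nab X Y).
Proof.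
move=> vX vY; apply/funext => x; apply/funext => f.
rewrite fscaleE nabla_linr //; [|exact: smooth_cst|exact: vfield0].
by rewrite (tangent_cst _ (vX.1 x)) nabla0r // mul0r add0r addr0.
Qed.

(** Torsion-freeness exhibits the bracket as a difference of covariant derivatives, which avoids any
    computation with second derivatives. *)
Lemma vfield_bracket X Y : is_vfield X -> is_vfield Y -> is_vfield (bracket X Y).
Proof.
by move=> vX vY; rewrite -(nabla_torsion_free S vX vY); apply: vfield_fsub;
   apply: nabla_vfield.
Qed.

Lemma nabla_swap X Y x f : is_vfield X -> is_vfield Y ->
  nab X Y x f = nab Y X x f + bracket X Y x f.
Proof. by move=> vX vY; rewrite -(nabla_torsion_free S vX vY) /fsub addrC subrK. Qed.

(* Torsion-freeness and [d_nabla J = 0] give both the difference and the sum of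
   [nabla_W H] and [nabla_H W]. *)
Lemma nabla01_eq0 (K W : vfield M) : is_vfield10 K -> is_vfield W ->
  fJ W = fscale (- 'i%C) W -> fJ (bracket K W) = fscale (- 'i%C) (bracket K W) ->
  nab W K = fun=> (fun=> 0).
Proof.
move=> K10 vW JW JB; have vK := K10.1; apply/funext => x; apply/funext => f.
have := nabla_dJ S vK vW.
rewrite (fJ10 K10) JW JB !nabla_fscale //.
move/(congr1 (fun F => F x f)); rewrite /fsub /fscale /vscale.
rewrite (nabla_swap x f vK vW); set A := nab W K x f; set B := bracket K W x f => h.
have /eqP : (2%:R * 'i%C) * A = 0.
  by apply: oppr_inj; rewrite oppr0 -[RHS]h; ring.
by rewrite !mulf_eq0 (negbTE (two_neq0 R)) (negbTE (i_neq0 R)) => /eqP.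
Qed.

(** For [Z] of type (1,0), the term (nabla_Y pi10) Z is nabla_Y Z minus its (1,0) part, and Phi of
    two vectors of type (1,0) is zero. *)
Lemma cubic_kform X Y Z x : is_vfield10 X -> is_vfield10 Y -> is_vfield10 Z ->
  cubic S X Y Z x = kform x (X x) (nab Y Z x).
Proof.
move=> X10 Y10 Z10; rewrite /cubic (fpi10_id X10) (fpi10_id Z10) PhiE.
have tN : tangent x (nab Y Z x) by apply: (nabla_vfield S Y10.1 Z10.1).1.
have tX : tangent x (X x) := X10.1.1 x.
have tp := tangent_pi10 tN.
rewrite fsubE /flin kform_linr // [fpi10 _ x]/(pi10 x (nab Y Z x)).
by rewrite kform10 ?mulr0 ?add0r //; [exact: (X10.2 x).2 | exact: J_pi10].
Qed.

Lemma cubic_smooth X Y Z : is_vfield10 X -> is_vfield10 Y -> is_vfield10 Z ->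
  smooth (cubic S X Y Z).
Proof.
move=> X10 Y10 Z10; rewrite (_ : cubic S X Y Z =
    fun x => metric S x (X x) (fJ (nab Y Z) x)).
  apply: metric_smooth; first exact: X10.1.
  exact/vfield_fJ/(nabla_vfield S Y10.1 Z10.1).
by apply/funext => x; rewrite cubic_kform.
Qed.

(** Stated for a general [V] to cover H, with constant c, and conj H, with constant 0. The factor 2
    counts the slots of Phi(X, nabla_Y Z): [nab V] multiplies each of them by [c]. *)
Lemma cubic_derivative (c : C) V X Y Z x : is_vfield V ->
  is_vfield10 X -> is_vfield10 Y -> is_vfield10 Z ->
  nab X V = fscale c X -> nab Z V = fscale c Z ->
  (forall W, W = X \/ W = Y \/ W = Z -> bracket V W = fun=> (fun=> 0)) ->
  V x (cubic S X Y Z) = 2%:R * c * cubic S X Y Z x.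
Proof.
move=> vV X10 Y10 Z10 XV ZV B0.
have [vX vY vZ] : [/\ is_vfield X, is_vfield Y & is_vfield Z].
  by split; [exact: X10.1|exact: Y10.1|exact: Z10.1].
have nV (W : vfield M) : is_vfield W -> nab W V = fscale c W -> bracket V W = (fun=> (fun=> 0)) ->
    nab V W = fscale c W.
  move=> vW WV B; apply/funext => y; apply/funext => f.
  by rewrite nabla_swap // WV B addr0.
have VX := nV _ vX XV (B0 _ (or_introl erefl)).
have VZ := nV _ vZ ZV (B0 _ (or_intror (or_intror erefl))).
have vN := nabla_vfield S vY vZ.
(* By flatness and [V, Y] = 0, [nab V] commutes with [nab Y]. *)
have VN : nab V (nab Y Z) = fscale c (nab Y Z).
  have := nabla_flat S vV vY vZ; rewrite (B0 Y); last by right; left.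
  rewrite nabla0l // VZ nabla_fscale // => h.
  apply/funext => y; apply/funext => f; have := congr1 (fun F => F y f) h.
  by rewrite /fsub => /eqP; rewrite subr_eq0 => /eqP.
rewrite (_ : cubic S X Y Z = Phi S X (nab Y Z)); last first.
  by apply/funext => y; rewrite cubic_kform.
rewrite nabla_Phi // VX VN !PhiE kform_scalel ?kform_scaler //;
  try exact: (vX.1 x); try exact: (vN.1 x).
ring.
Qed.

End SpecialKahler.

(** * Adapted charts *)

Section Continuity.
Variable R : realType.
Local Notation C := R[i].

Lemma continuous_zc m n (T : cspace R m -> cspace R n) p :
  (forall j, cdiff (fun q => zc (T q) j) p) -> {for p, continuous T}.
Proof. by move=> /differentiable_comp_coord[dT _]; apply: differentiable_continuous. Qed.

Lemma continuous_smooth_near m n (M : cmanifold R m) (T : M -> cspace R n) x :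
  (forall j, smooth_near (fun y => zc (T y) j) x) -> {for x, continuous T}.
Proof.
move=> sT; have [phi ap px] := atlas_cover x; have hp := atlas_holo_chart ap.
have Tc : {for fwd phi x, continuous (T \o bwd phi)}.
  apply: continuous_zc => j; apply: csmooth_cdiff.
  exact: ((smooth_nearP (fun y => zc (T y) j) hp px).1 (sT j)).
move=> A TA; have TA' : nbhs ((T \o bwd phi) (fwd phi x)) A by rewrite /= fwdK.
have := near_fwd px (Tc _ TA' : \forall q \near fwd phi x, A (T (bwd phi q))).
move=> h; suff: \forall y \near x, A (T y) by [].
by apply: filterS2 (near_cdom px) h => y py; rewrite fwdK.
Qed.

End Continuity.

Section HoloMaps.
Variables (R : realType) (m n : nat) (M : cmanifold R m) (N : cmanifold R n).
Variables (F : M -> N) (x : M).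
Hypothesis hF : holo_map F x.

Lemma holo_map_coord_smooth (phi : chart R N n) j : atlas phi -> cdom phi (F x) ->
  smooth_near (coord phi j \o F) x.
Proof.
move=> ap px; apply: holo_smooth; apply: hF.2.
by apply: coord_holo => //; exact: atlas_holo_chart.
Qed.

Lemma holo_map_near (Q : set N) : (\forall z \near F x, Q z) -> \forall y \near x, Q (F y).
Proof. by move=> QF; apply: hF.1. Qed.

Lemma holo_map_near_chart (phi : chart R N n) (f : N -> R[i]) : cdom phi (F x) ->
  \forall y \near x, (f \o F) y = (f \o bwd phi) ((fwd phi \o F) y).
Proof.
by move=> px; apply: filterS (holo_map_near (near_cdom px)) => y py /=; rewrite fwdK.
Qed.

Lemma holo_map_smooth f : smooth_near f (F x) -> smooth_near (f \o F) x.
Proof.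
move=> sf; have [phi ap px] := atlas_cover (F x); have hp := atlas_holo_chart ap.
have sg : smooth_near ((f \o bwd phi) \o (fwd phi \o F)) x.
  apply: smooth_near_comp; first by move=> j; exact: holo_map_coord_smooth.
  exact/(smooth_nearP f hp px).
by apply: smooth_near_eq sg; apply: filterS (holo_map_near_chart f px) => y ->.
Qed.

Lemma pushforwardE (phi : chart R N n) v : atlas phi -> cdom phi (F x) -> tangent x v ->
  pushforward F x v = tvec phi (fun j => v (coord phi j \o F))
                               (fun j => v (cconj (coord phi j) \o F)) (F x).
Proof.
move=> ap px tv; have hp := atlas_holo_chart ap; apply/funext => f.
rewrite /pushforward /tvec; case: ifPn => // /asboolP sf.
rewrite (@tangent_comp _ _ _ _ x v _ (f \o bwd phi) (fwd phi \o F)) //.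
- exact: holo_map_near_chart.
- by move=> j; exact: holo_map_coord_smooth.
- exact/(smooth_nearP f hp px).
Qed.

Lemma tangent_pushforward v : tangent x v -> tangent (F x) (pushforward F x v).
Proof.
move=> tv; have [phi ap px] := atlas_cover (F x); have hp := atlas_holo_chart ap.
by rewrite (pushforwardE ap px tv); exact: tangent_tvec.
Qed.

End HoloMaps.

Section AdaptedCharts.
Variables (R : realType) (n : nat) (Mt : cmanifold R n.+1) (M : cmanifold R n).
Variable P : projective_special_kahler Mt M.
Local Notation C := R[i].
Local Notation pi := (proj P).
Local Notation act := (act P).
Implicit Types (x z : Mt) (b : C) (chi : chart R Mt n.+1).

Lemma proj_act b x : b != 0 -> pi (act b x) = pi x.
Proof. by move=> b0; apply/esym/(proj_fiber P); exists b. Qed.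

Lemma act_injl a b x : a != 0 -> b != 0 -> act a x = act b x -> a = b.
Proof.
move=> a0 b0 ab; apply: (mulfI (invr_neq0 b0)); rewrite mulVf //.
apply: (@act_free _ _ _ _ P _ x); first by rewrite mulf_neq0 ?invr_neq0.
by rewrite act_M ?invr_neq0 // ab -act_M ?invr_neq0 // mulVf // act_1.
Qed.

(** * An adapted chart from a local trivialisation and a chart of the base *)

Section Construction.
Variables (U : set M) (s : M -> Mt) (y : Mt -> C) (phi : chart R M n).
Hypothesis Uo : open U.
Hypothesis sP : forall q, U q -> holo_map s q /\ pi (s q) = q.
Hypothesis yP : forall x, U (pi x) ->
  [/\ holo_near y x, y x != 0 & act (y x) (s (pi x)) = x].
Hypothesis ap : atlas phi.

Let D : set Mt := [set x | U (pi x) /\ cdom phi (pi x)].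
Let fw (x : Mt) : cspace R n.+1 :=
  cpack (fun j => if unlift ord0 j is Some i then coord phi i (pi x) else y x).
Let tl (q : cspace R n.+1) : cspace R n := cpack (fun i => zc q (lift ord0 i)).
Let bw (q : cspace R n.+1) : Mt := act (zc q ord0) (s (bwd phi (tl q))).

Let fw0 x : zc (fw x) ord0 = y x.
Proof. by rewrite zc_cpack unlift_none. Qed.
Let fwS x i : zc (fw x) (lift ord0 i) = coord phi i (pi x).
Proof. by rewrite zc_cpack liftK. Qed.
Let tl_fw x : tl (fw x) = fwd phi (pi x).
Proof. by apply: cspace_ext => i; rewrite zc_cpack fwS. Qed.

Let D_open : open D.
Proof.
rewrite openE => x [Ux px].
have n1 : \forall p \near pi x, U p by exact: open_nbhs_nbhs.
have n2 : \forall p \near pi x, U p /\ cdom phi p.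
  by apply: filterS2 n1 (near_cdom px) => p Up pp.
exact: (holo_map_near (proj_holo P x) n2).
Qed.

Let fwK x : D x -> bw (fw x) = x.
Proof. by move=> [Ux px]; rewrite /bw fw0 tl_fw fwdK //; have [] := yP Ux. Qed.

(** Equivariance of [y] follows from freeness: [y (act b z)] and [b * y z] both carry the point of
    the section to [act b z]. *)
Let y_act b z : b != 0 -> U (pi z) -> y (act b z) = b * y z.
Proof.
move=> b0 Uz; have [_ y0 yE] := yP Uz.
have Ubz : U (pi (act b z)) by rewrite proj_act.
have [_ y0' yE'] := yP Ubz.
apply: (@act_injl _ _ (s (pi z))) => //; first by rewrite mulf_neq0.
by rewrite act_M // yE -{1}(proj_act z b0).
Qed.

(** The image is the product of the punctured plane and an open set of C^n; its openness is read off
    from this description. *)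
Let image_fw q : (fw @` D) q <->
  zc q ord0 != 0 /\ exists2 p, U p /\ cdom phi p & fwd phi p = tl q.
Proof.
split=> [[x [Ux px] <-]|[q0 [p [Up pp] pq]]].
  rewrite fw0 tl_fw; split; first by have [] := yP Ux.
  by exists (pi x).
have pE : pi (act (zc q ord0) (s p)) = p by rewrite proj_act //; have [] := sP Up.
exists (act (zc q ord0) (s p)); first by rewrite /D /= pE.
apply: cspace_ext => j; case: (unliftP ord0 j) => [i ->|->].
  by rewrite fwS pE /coord pq zc_cpack.
rewrite fw0; have [|_ y0 yE] := @yP (act (zc q ord0) (s p)); first by rewrite pE.
by rewrite pE in yE; exact: act_injl y0 q0 yE.
Qed.

Let tl_cont q : {for q, continuous tl}.
Proof.
apply: continuous_zc => i; rewrite (_ : (fun _ => _) = fun q => zc q (lift ord0 i)).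
  exact: cdiff_zc.
by apply/funext => r; rewrite zc_cpack.
Qed.

Let image_open : open (fw @` D).
Proof.
rewrite openE => q /image_fw[q0 [p [Up pp] pq]].
have n0 := cdiff_neq0_near (cdiff_zc ord0 q) q0.
have n1 : \forall r \near fwd phi p, U (bwd phi r).
  by apply: (near_bwd pp); apply: open_nbhs_nbhs.
have n2 : nbhs (tl q) [set r | exists2 p, U p /\ cdom phi p & fwd phi p = r].
  rewrite -pq; apply: filterS2 n1 (near_ccod pp) => r Ur [pr rE].
  by exists (bwd phi r).
have n3 : \forall r \near q, exists2 p, U p /\ cdom phi p & fwd phi p = tl r.
  exact: (@tl_cont q _ n2).
suff: \forall r \near q, (fw @` D) r by [].
by apply: filterS2 n0 n3 => r r0 rp; apply/image_fw.
Qed.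

Let coord_fw_holo x j : D x -> holo_near (fun z => zc (fw z) j) x.
Proof.
move=> [Ux px]; case: (unliftP ord0 j) => [i ->|->].
  rewrite (_ : (fun z => _) = coord phi i \o pi); last by apply/funext => z; rewrite fwS.
  apply: (proj_holo P x).2; apply: coord_holo => //; exact: atlas_holo_chart.
rewrite (_ : (fun z => _) = y); last by apply/funext => z; rewrite fw0.
by have [] := yP Ux.
Qed.

Let fw_cont x : D x -> {for x, continuous fw}.
Proof.
by move=> Dx; apply: continuous_smooth_near => j; exact/holo_smooth/coord_fw_holo.
Qed.

(** Near [q], [bw] is the action in coordinates after a map [W] that pairs the first coordinate with
    the section read in a chart [psi]. [W] is holomorphic coordinate by coordinate, and the action
    is jointly holomorphic. *)
Let bw_holo q : (fw @` D) q ->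
  {for q, continuous bw} /\ forall f, holo_near f (bw q) -> cholo (f \o bw) q.
Proof.
move=> /image_fw[q0 [p [Up pp] pq]].
have [hs _] := sP Up; have [psi apsi spsi] := atlas_cover (s p).
have bwq : bwd phi (tl q) = p by rewrite -pq fwdK.
have [/= Ac Ah] := act_holo P q0 apsi spsi.
set A := (X in {for _, continuous X}) in Ac; set w0 := cjoin _ _ in Ac Ah.
pose st r := s (bwd phi (tl r)).
pose W r := cjoin (cpt1 (zc r ord0)) (fwd psi (st r)).
have Wq : W q = w0 by rewrite /W /st bwq.
have Wh j : cholo (fun r => zc (W r) j) q.
  case: (split_ordP j) => k ->.
    rewrite (_ : (fun r => _) = fun r => zc r ord0); first exact: cholo_zc.
    by apply/funext => r; rewrite /zc /W /cjoin /cpt1 /= !row_mxEl !mxE.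
  rewrite (_ : (fun r => _) = ((coord psi k \o s) \o bwd phi) \o tl); last first.
    by apply/funext => r; rewrite /zc /W /cjoin /= !row_mxEr.
  apply: cholo_comp => [i|].
    rewrite (_ : (fun q => _) = fun q => zc q (lift ord0 i)); first exact: cholo_zc.
    by apply/funext => r; rewrite zc_cpack.
  rewrite -pq; apply/(holo_nearP _ (atlas_holo_chart ap) pp); apply: hs.2.
  exact/coord_holo/spsi/atlas_holo_chart.
have Wc : {for q, continuous W} by apply: continuous_zc => j; exact: (csmooth_cdiff (proj1 (Wh j))).
have st_near : \forall r \near q, cdom psi (st r).
  have n1 : \forall r \near tl q, cdom psi (s (bwd phi r)).
    by rewrite -pq; exact: (near_bwd pp (holo_map_near hs (near_cdom spsi))).
  exact: (@tl_cont q _ n1).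
(* The factorisation holds only near [q], where the section stays in the domain of [psi]. *)
have bwE : \forall r \near q, bw r = A (W r).
  apply: filterS st_near => r cr.
  have -> : A (W r) = act (zc (cpt1 (zc r ord0)) ord0) (bwd psi (fwd psi (st r))).
    rewrite /A /W /cjoin /cfst /csnd /= !row_mxKl !row_mxKr; congr (act _ (bwd psi _)).
    by case: (fwd psi _).
  rewrite fwdK // /bw; congr (act _ _).
  by apply: complex_ext; rewrite /= mxE.
have bwA : bw q = A w0 by rewrite -Wq (nbhs_singleton bwE).
have A0 : A w0 = act (zc q ord0) (s p) by rewrite -bwA /bw bwq.
split.
  move=> B; rewrite bwA => AB.
  suff: \forall r \near q, B (bw r) by [].
  have n1 : \forall r \near q, B (A (W r)).
    suff: nbhs q (W @^-1` (A @^-1` B)) by [].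
    by apply: Wc; rewrite Wq; apply: Ac.
  by apply: filterS2 bwE n1 => r ->.
move=> f; rewrite bwA A0 => /Ah hf.
apply: (@cholo_eq_near _ _ ((f \o A) \o W)).
  by apply: filterS bwE => r rE; rewrite /= -rE.
by apply: cholo_comp => //; rewrite Wq.
Qed.

Definition adapted_chart : chart R Mt n.+1 :=
  Chart D_open image_open fwK fw_cont (fun p hp => (bw_holo hp).1).

Lemma adapted_chartP : adapted P adapted_chart /\
  forall x i, coord adapted_chart (lift ord0 i) x = coord phi i (pi x).
Proof.
split; last by move=> x i; rewrite /coord /= fwS.
split=> [psi apsi|b x b0 [Ux px]]; last first.
  split; first by rewrite /= /D /= proj_act.
    by rewrite /coord /= !fw0 y_act.
  by move=> i; rewrite /coord /= !fwS proj_act.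
split=> x cx cx' j.
  by apply/(holo_nearP _ (atlas_holo_chart apsi) cx); exact: coord_fw_holo.
apply: (bw_holo (imageP fw cx)).2; rewrite fwK //.
by apply: coord_holo => //; exact: atlas_holo_chart.
Qed.

End Construction.

(** Besides being adapted, the chart has its last n coordinates pulled back from a chart of the
    base, so that they compute pushforwards. *)
Lemma adapted_exists x : exists chi phi, [/\ adapted P chi, cdom chi x, atlas phi &
  forall z, cdom chi z -> cdom phi (pi z) /\
    forall i, coord chi (lift ord0 i) z = coord phi i (pi z)].
Proof.
have [U [s [y [Uo Up sP yP]]]] := proj_trivial P (pi x).
have [phi ap px] := atlas_cover (pi x).
have [ad adP] := adapted_chartP Uo sP yP ap.
exists (adapted_chart Uo sP yP ap), phi; split=> //.
move=> z [_ pz]; split=> // i; exact: adP.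
Qed.

(** If y vanished at [x], acting by 2 would fix [x], against freeness. *)
Lemma adapted_coord0_neq0 chi x : adapted P chi -> cdom chi x -> coord chi ord0 x != 0.
Proof.
move=> [hchi ad] cx; apply/eqP => y0.
have two0 := two_neq0 R.
have [c2 e0 eS] := ad 2%:R x two0 cx.
have : act 2%:R x = x.
  rewrite -[RHS](fwdK cx) -[LHS](fwdK c2); congr (bwd chi _).
  apply: cspace_ext => j; case: (unliftP ord0 j) => [i ->|->]; first exact: eS.
  by rewrite -/(coord chi ord0 _) -/(coord chi ord0 _) e0 y0 mulr0.
move=> /(act_free two0)/eqP; rewrite -subr_eq0 (_ : 2%:R - 1 = 1); last by ring.
by rewrite oner_eq0.
Qed.

End AdaptedCharts.

(** * The fundamental vector field *)

Section LogDerivative.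
Variable R : realType.
Local Notation C := R[i].

Lemma derive_ln_comp (V : normedModType R) (h : V -> R) p v :
  differentiable h p -> 0 < h p -> 'D_v (fun q => ln (h q)) p = 'D_v h p / h p.
Proof.
move=> hd hp.
have dl : differentiable (@ln R) (h p).
  by apply/derivable1_diffP; exact: (@ex_derive _ _ _ _ _ _ _ (is_derive1_ln hp)).
have dc : differentiable (fun q => ln (h q)) p by apply: (differentiable_comp hd dl).
rewrite (deriveE v dc) (deriveE v hd) (diff_comp hd dl) /=.
rewrite diff1E //; congr (_ * _).
by rewrite derive1E (@derive_val _ _ _ _ _ _ _ (is_derive1_ln hp)).
Qed.

(** The metric has arbitrary signature, so [k] may be negative; the sign cancels in the quotient. *)
Lemma derive_ln_norm (V : normedModType R) (k : V -> R) p v :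
  differentiable k p -> k p != 0 -> 'D_v (fun q => ln `|k q|) p = 'D_v k p / k p.
Proof.
move=> kd k0.
have kc : {for p, continuous k} := differentiable_continuous kd.
have [kn|kp] : k p < 0 \/ 0 < k p by apply/orP; rewrite -neq_lt.
  have nkd : differentiable (- k) p by exact: differentiableN.
  rewrite (@near_eq_derive _ _ _ _ (fun q => ln ((- k) q)) p v); last first.
    have : \forall q \near p, k q < 0 by apply: (kc [set r | r < 0]); exact: lt_nbhsl.
    by apply: filterS => q kq; rewrite ltr0_norm.
  rewrite derive_ln_comp //; last by rewrite oppr_gt0.
  by rewrite deriveN ?invrN ?mulrNN //; exact: diff_derivable.
rewrite (@near_eq_derive _ _ _ _ (fun q => ln (k q)) p v) ?derive_ln_comp //.
have : \forall q \near p, 0 < k q by apply: (kc [set r | 0 < r]); exact: lt_nbhsr.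
by apply: filterS => q kq; rewrite gtr0_norm.
Qed.

Lemma dder_ln_norm m (F : cspace R m -> C) p v : cdiff F p -> F p != 0 ->
  (forall q, F q = ((complex.Re (F q))%:C)%C) ->
  dder v (fun q => ((ln (complex.Re `|F q|))%:C)%C) p = (F p)^-1 * dder v F p.
Proof.
move=> [Fr Fi] F0 FR.
have k0 : repart F p != 0.
  by apply: contraNneq F0 => k0; rewrite FR -/(repart F p) k0.
have Im0 : impart F = fun=> 0 by apply/funext => q; rewrite /impart FR.
have dE : dder v F p = (('D_v (repart F) p)%:C)%C.
  by apply: complex_ext; rewrite ?repart_dder // impart_dder Im0 derive_cst.
rewrite dE (FR p) -fmorphV -rmorphM.
apply: complex_ext; rewrite ?repart_dder ?impart_dder ?Re_real ?Im_real; last first.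
  exact: derive_cst.
rewrite (_ : repart _ = fun q => ln `|repart F q|); last first.
  apply/funext => q; rewrite /repart Re_real; congr ln.
  by rewrite {1}(FR q) normc_def Re_real Im_real Re_real expr0n addr0 sqrtr_sqr.
by rewrite (derive_ln_norm v Fr k0) mulrC.
Qed.

End LogDerivative.

Section Fundamental.
Variables (R : realType) (n : nat) (Mt : cmanifold R n.+1) (M : cmanifold R n).
Variable P : projective_special_kahler Mt M.
Local Notation C := R[i].
Local Notation pi := (proj P).
Local Notation act := (act P).
Local Notation Hf := (H P).
Local Notation Hb := (fconj (H P)).
Local Notation c := (((cst P)%:C)%C : C).
Local Notation nab := (nabla P).
Implicit Types (x z : Mt) (b : C) (chi : chart R Mt n.+1) (X Y W : vfield Mt).

Lemma vH : is_vfield Hf. Proof. exact: (H_vfield10 P).1. Qed.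
Lemma vHb : is_vfield Hb. Proof. exact/vfield_fconj/vH. Qed.

Lemma c_neq0 : c != 0.
Proof. by rewrite fmorph_eq0 cst_neq0. Qed.

Lemma H_coord chi x j : adapted P chi -> cdom chi x ->
  Hf x (coord chi j) = (if j == ord0 then c else 0) * coord chi j x.
Proof.
move=> [hchi ad] cx; rewrite H_fundamental; last exact: coord_holo.
have w1 : zc (cpt1 (1 : C)) ord0 = 1 by apply: complex_ext; rewrite /= mxE.
(* Equivariance is available for b != 0 only, which holds near b = 1; the derivative at 1 sees no
   more. *)
have w0 : \forall w \near cpt1 (1 : C), zc w ord0 != 0.
  by apply: cdiff_neq0_near; [exact: cdiff_zc | rewrite w1 oner_eq0].
case: (unliftP ord0 j) => [i ->|->].
  rewrite [lift _ _ == _]eq_sym (negbTE (neq_lift _ _)) mul0r dz_wirt.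
  rewrite (@wirt_eq_near _ _ _ _ _ (fun=> coord chi (lift ord0 i) x)) ?wirt_cst ?mulr0 //.
  by apply: filterS w0 => w w0; have [_ _ ->] := ad _ x w0 cx.
rewrite eqxx dz_wirt (@wirt_eq_near _ _ _ _ _ (fun w => zc w ord0 * coord chi ord0 x)); last first.
  by apply: filterS w0 => w w0; have [_ -> _] := ad _ x w0 cx.
rewrite wirtM; [|exact: cdiff_zc|exact: cdiff_cst].
by rewrite wirt_cst mulr0 add0r wirt_zc eqxx mulr1.
Qed.

Lemma tangent_near0 x v (f : Mt -> C) : tangent x v -> (\forall z \near x, f z = 0) -> v f = 0.
Proof. by move=> tv f0; rewrite (tangent_eq_near tv f0) (tangent_cst _ tv). Qed.

(* [H] multiplies each adapted coordinate by a constant, so [W (H chi_j)] vanishes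
   together with [W chi_j]. *)
Lemma bracketH_coord chi x j W : adapted P chi -> cdom chi x -> is_vfield W ->
  (forall z, cdom chi z -> W z (coord chi j) = 0) -> bracket Hf W x (coord chi j) = 0.
Proof.
move=> ad cx vW W0; have [hchi _] := ad; have sc := coord_smooth j hchi cx.
rewrite bracketE // (tangent_near0 (vH.1 x)); last first.
  by apply: filterS (near_cdom cx) => z /W0.
rewrite (tangent_eq_near (g := fun z => (if j == ord0 then c else 0) * coord chi j z) (vW.1 x)).
  by rewrite (tangentZ _ (vW.1 x)) // W0 // mulr0 subrr.
by apply: filterS (near_cdom cx) => z cz; exact: H_coord.
Qed.

Lemma fconj_coord chi x j X : holo_chart chi -> is_vfield10 X -> cdom chi x ->
  fconj X x (coord chi j) = 0.
Proof.
move=> hchi X10 cx; rewrite /fconj /vconj (tangent10_conj (X10.2 x)) ?conjC0 //.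
exact: coord_holo.
Qed.

Lemma nabla_conj_H X : is_vfield10 X -> nab (fconj X) Hf = fun=> (fun=> 0).
Proof.
move=> X10; have vXb := vfield_fconj X10.1.
apply: nabla01_eq0 => //; [exact: H_vfield10|exact: fJ_fconj10|].
apply/funext => x; have [chi [phi [ad cx _ _]]] := adapted_exists P x.
have vB := vfield_bracket P vH vXb.
apply: (J01_coord ad.1 cx (vB.1 x)) => j.
by apply: (bracketH_coord ad cx vXb) => z cz; apply: fconj_coord => //; exact: ad.1.
Qed.

Lemma fconj0 : fconj (fun=> (fun=> 0) : vec Mt) = fun=> (fun=> 0).
Proof. by apply/funext => x; apply/funext => f; rewrite /fconj /vconj conjC0. Qed.

(** Complex conjugate of [nabla_conj_H], since the connection is real. *)
Lemma nabla_Hb X : is_vfield10 X -> nab X Hb = fun=> (fun=> 0).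
Proof.
move=> X10; have vXb := vfield_fconj X10.1.
by rewrite -[X]fconjK (nabla_real P vXb vH) nabla_conj_H // fconj0.
Qed.

Lemma nabla10_H X : is_vfield10 X -> nab X Hf = fscale c X.
Proof. exact: nabla_H. Qed.

Lemma nabla_Hb_Hb : nab Hb Hb = fscale c Hb.
Proof.
rewrite (nabla_real P vH vH) nabla10_H; last exact: H_vfield10.
apply/funext => x; apply/funext => f.
by rewrite /fconj /vconj /fscale /vscale rmorphM /= conj_real.
Qed.

(** Equal to c^2 times [calK], hence with the same logarithmic derivative. *)
Definition Hnorm x : C := metric P x (Hf x) (Hb x).

Lemma Hnorm_neq0 x : Hnorm x != 0. Proof. exact: H_nonisotropic. Qed.

Lemma Hnorm_smooth : smooth Hnorm.
Proof. by apply: metric_smooth; [exact: vH|exact: vHb]. Qed.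

Lemma Hnorm_real x : (Hnorm x)^* = Hnorm x.
Proof.
rewrite /Hnorm -metric_real; [|exact: vH.1|exact: vHb.1].
by rewrite {2}/fconj vconjK metric_sym //; [exact: vHb.1|exact: vH.1].
Qed.

Lemma kform_Hb x u : tangent x u -> kform P x u (Hb x) = - 'i%C * metric P x u (Hb x).
Proof.
move=> tu; rewrite /kform; have /(congr1 (@^~ x)) := fJ_fconj10 (H_vfield10 P).
by rewrite /fJ /fscale => ->; rewrite metric_scaler //; exact: vHb.1.
Qed.

(** The connection is given to preserve Phi, not the metric, so the derivative is taken of Phi(H,
    conj H) = -i Hn. *)
Lemma vfield10_Hnorm X x : is_vfield10 X -> X x Hnorm = c * metric P x (X x) (Hb x).
Proof.
move=> X10; have := nabla_Phi P X10.1 vH vHb x.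
rewrite nabla_Hb // nabla10_H // !PhiE kform0r ?addr0; last exact: vH.1.
rewrite kform_scalel; [|exact: X10.1.1|exact: vHb.1].
rewrite kform_Hb; last exact: X10.1.1.
rewrite (_ : Phi P Hf Hb = fun z => - 'i%C * Hnorm z); last first.
  by apply/funext => z; rewrite PhiE kform_Hb //; exact: vH.1.
rewrite (tangentZ _ (X10.1.1 x)); last exact: Hnorm_smooth.
by rewrite mulrCA => /(mulfI _)->//; rewrite oppr_eq0 i_neq0.
Qed.

Lemma H_Hnorm x : Hf x Hnorm = c * Hnorm x.
Proof. exact/vfield10_Hnorm/H_vfield10. Qed.

Lemma tangent10_chart chi x v f : holo_chart chi -> cdom chi x -> tangent10 x v ->
  smooth_near f x ->
  v f = \sum_j v (coord chi j) * dz j (f \o bwd chi) (fwd chi x).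
Proof.
move=> hchi cx v10 sf; rewrite {1}(tangentE hchi cx v10.1) tvecE //.
apply: eq_bigr => j _; rewrite (tangent10_conj v10) ?mul0r ?addr0 //.
exact: coord_holo.
Qed.

(** Euler's relation: with H = c y d/dy, the equation H(Hn) = c Hn makes Hn of degree 1 in y. *)
Lemma dz0_Hnorm chi x : adapted P chi -> cdom chi x ->
  coord chi ord0 x * dz ord0 (Hnorm \o bwd chi) (fwd chi x) = Hnorm x.
Proof.
move=> ad cx; apply: (mulfI c_neq0); rewrite -H_Hnorm.
rewrite (tangent10_chart ad.1 cx ((H_vfield10 P).2 x) (Hnorm_smooth x)).
rewrite big_ord_recl big1 => [|i _]; first by rewrite H_coord // eqxx addr0 mulrA.
by rewrite H_coord // [_ == _]eq_sym (negbTE (neq_lift _ _)) !mul0r.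
Qed.

Lemma dz_logK chi x j : holo_chart chi -> cdom chi x ->
  dz j (logK P \o bwd chi) (fwd chi x) =
  (Hnorm x)^-1 * dz j (Hnorm \o bwd chi) (fwd chi x).
Proof.
move=> hchi cx; have sG := (smooth_nearP _ hchi cx).1 (Hnorm_smooth x).
have cG := csmooth_cdiff sG.
have GE : (Hnorm \o bwd chi) (fwd chi x) = Hnorm x by rewrite /= fwdK.
have a0 : c ^- 2 != 0 by rewrite invr_neq0 // expf_neq0 // c_neq0.
pose F q := c ^- 2 * (Hnorm \o bwd chi) q.
have Fp : F (fwd chi x) != 0 by rewrite /F GE mulf_neq0 // Hnorm_neq0.
have Freal q : F q = ((complex.Re (F q))%:C)%C.
  apply/esym/RRe_real/CrealP; rewrite /F rmorphM fmorphV rmorphXn /= conj_real.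
  by rewrite Hnorm_real.
have cF : cdiff F (fwd chi x) by apply: cdiffM => //; exact: cdiff_cst.
have dE v : dder v (logK P \o bwd chi) (fwd chi x) =
    (Hnorm x)^-1 * dder v (Hnorm \o bwd chi) (fwd chi x).
  rewrite (_ : logK P \o bwd chi = fun q => ((ln (complex.Re `|F q|))%:C)%C) //.
  have dF : dder v F (fwd chi x) = c ^- 2 * dder v (Hnorm \o bwd chi) (fwd chi x).
    by rewrite [LHS](dderM v (cdiff_cst _ _) cG) dder_cst mulr0 addr0.
  by rewrite (dder_ln_norm v cF Fp Freal) dF /F GE invfM mulrACA mulVf // mul1r.
by rewrite /dz !dE; move: (dder _ _ _) (dder _ _ _) => A B; ring.
Qed.

(** By Euler's relation dy / y is the y-term of d(Hn) / Hn, which completes the sum over the z^i. *)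
Lemma omegaE chi x v : adapted P chi -> cdom chi x -> tangent10 x v ->
  omega P chi x v = (Hnorm x)^-1 * v Hnorm.
Proof.
move=> ad cx v10; rewrite (tangent10_chart ad.1 cx v10 (Hnorm_smooth x)).
rewrite big_ord_recl mulrDr /omega; congr (_ + _).
  have y0 := adapted_coord0_neq0 ad cx; have G0 := Hnorm_neq0 x.
  apply: (mulfI y0); rewrite mulrA divff // mul1r.
  rewrite mulrCA [_ * (v _ * _)]mulrCA dz0_Hnorm //.
  by rewrite mulrCA mulVf // mulr1.
rewrite mulr_sumr; apply: eq_bigr => i _; rewrite dz_logK //; last exact: ad.1.
by rewrite -mulrA [_ * v _]mulrC.
Qed.

End Fundamental.

(** * Horizontal lifts *)

Section Segments.
Variable R : realType.
Local Notation C := R[i].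

Lemma derive0_segment (V : normedModType R) (h : V -> R) (p v : V) :
  (forall t : R, 0 <= t <= 1 -> differentiable h (p + t *: v) /\ 'D_v h (p + t *: v) = 0) ->
  h (p + v) = h p.
Proof.
move=> hd; pose l (t : R) : V := p + t *: v; pose k := h \o l.
have ld (t : R) : differentiable l t.
  by apply: differentiableD; [exact: differentiable_cst|exact: differentiableZl].
have lD (t : R) : 'D_1 l t = v.
  rewrite /l deriveD; [|exact: derivable_cst|apply: diff_derivable; exact: differentiableZl].
  rewrite derive_cst add0r deriveE; last exact: differentiableZl.
  by rewrite (diffZl v (@ex_diff _ _ _ _ _ _ _ _)) -deriveE // derive_id scale1r.
have kd (t : R) : 0 <= t <= 1 -> is_derive t 1 k 0.
  move=> /hd[hdt h0]; have kdt : differentiable k t by exact: differentiable_comp (ld t) hdt.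
  apply: DeriveDef; first exact: diff_derivable.
  rewrite (deriveE _ kdt) (diff_comp (ld t) hdt) /= -(deriveE _ (ld t)) lD.
  by rewrite -(deriveE v hdt).
have kc : {within `[0, 1], continuous k}.
  apply: derivable_within_continuous => t; rewrite in_itv /= => /kd t01.
  exact: ex_derive.
have [] := @MVT R k (fun=> 0) 0 1 ltr01 _ kc.
  by move=> t; rewrite in_itv /= => /andP[t0 t1]; apply: kd; rewrite !ltW.
move=> t _; rewrite mul0r => /eqP; rewrite subr_eq0 /k /l /= scale1r scale0r addr0.
by move/eqP.
Qed.

Lemma dder0_segment m (F : cspace R m -> C) p v :
  (forall t : R, 0 <= t <= 1 -> cdiff F (p + t *: v) /\ dder v F (p + t *: v) = 0) ->
  F (p + v) = F p.
Proof.
move=> Fd; apply: complex_ext.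
  apply: (@derive0_segment _ (repart F) p v) => t /Fd[[Fr _] F0]; split=> //.
  by rewrite -repart_dder F0.
apply: (@derive0_segment _ (impart F) p v) => t /Fd[[_ Fi] F0]; split=> //.
by rewrite -impart_dder F0.
Qed.

(** The hypothesis places b off the closed negative real half-line, the only position in which the
    segment from 1 to b meets 0. *)
Lemma segment_neq0 (b : C) (t : R) : complex.Im b != 0 \/ 0 < complex.Re b ->
  0 <= t <= 1 -> 1 + (t%:C)%C * (b - 1) != 0.
Proof.
case: b => x y /= hb /andP[t0 t1]; apply/eqP => /eqP; rewrite eq_complex /=.
rewrite !mul0r !subr0 !addr0 !add0r => /andP[/eqP h1 /eqP h2].
have tn0 : t != 0 by apply/eqP => t00; move: h1; rewrite t00; lra.
case: hb => [y0|x0]; last by nra.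
by move/eqP: h2; rewrite mulf_eq0 (negbTE tn0) (negbTE y0).
Qed.

End Segments.

Section Lift.
Variables (R : realType) (n : nat) (Mt : cmanifold R n.+1) (M : cmanifold R n).
Variable P : projective_special_kahler Mt M.
Local Notation C := R[i].
Local Notation pi := (proj P).
Local Notation act := (act P).
Local Notation Hf := (H P).
Local Notation Hb := (fconj (H P)).
Local Notation Hn := (Hnorm P).
Local Notation c := (((cst P)%:C)%C : C).
Local Notation nab := (nabla P).
Implicit Types (x z : Mt) (b : C) (chi : chart R Mt n.+1) (phi : chart R M n).
Implicit Types (X Y Z : vfield M) (v w : vec Mt).

(** Horizontal lift at a point, free of charts: by [omegaE], [v Hn = 0] expresses that [omega]
    vanishes on [v] in any adapted chart around [x]. *)
Definition lift_at X x v : Prop :=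
  [/\ tangent10 x v, pushforward pi x v = X (pi x) & v Hn = 0].

Definition projecting chi phi : Prop := forall z, cdom chi z -> cdom phi (pi z) /\
  forall i, coord chi (lift ord0 i) z = coord phi i (pi z).

Lemma tangent_proj_coord chi phi x v i : adapted P chi -> cdom chi x -> projecting chi phi ->
  atlas phi -> tangent x v ->
  v (coord chi (lift ord0 i)) = pushforward pi x v (coord phi i) /\
  v (cconj (coord chi (lift ord0 i))) = pushforward pi x v (cconj (coord phi i)).
Proof.
move=> ad cx prj ap tv; have hp := atlas_holo_chart ap; have [px _] := prj _ cx.
have sc := coord_smooth i hp px.
rewrite /pushforward !asboolT //; last exact: smooth_nearJ.
split; apply: (tangent_eq_near tv); apply: filterS (near_cdom cx) => z /prj[_ zE].
  exact: zE.
by rewrite /cconj /= zE.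
Qed.

(** In [v Hn] the component v(y) has the coefficient d(Hn)/dy = Hn / y, which is nonzero, so the
    equation can be solved for it. *)
Lemma lift_coord0 chi x v : adapted P chi -> cdom chi x -> tangent10 x v ->
  v Hn = 0 <-> v (coord chi ord0) = - (Hn x)^-1 * coord chi ord0 x *
    \sum_(i < n) v (coord chi (lift ord0 i)) *
                 dz (lift ord0 i) (Hn \o bwd chi) (fwd chi x).
Proof.
move=> ad cx v10; rewrite (tangent10_chart ad.1 cx v10 (Hnorm_smooth P x)) big_ord_recl.
have := dz0_Hnorm ad cx; set S := \sum_(i < n) _.
set D := dz ord0 _ _; set y := coord chi ord0 x => yD.
have G0 := Hnorm_neq0 P x; have y0 := adapted_coord0_neq0 ad cx.
move: (Hn x) (v _) D S y yD G0 y0 => g a {}D {}S {}y yD g0 y0.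
split=> [/eqP|->].
  rewrite addr_eq0 => /eqP aD; apply: (mulIf g0); rewrite -{1}yD mulrCA aD.
  by field.
rewrite (_ : _ * D = - g^-1 * (y * D) * S); last by ring.
by rewrite yD; field.
Qed.

Lemma lift_unique X x v w : lift_at X x v -> lift_at X x w -> v = w.
Proof.
move=> [v10 pv vn] [w10 pw wn]; have [chi [phi [ad cx ap prj]]] := adapted_exists P x.
have vw i : v (coord chi (lift ord0 i)) = w (coord chi (lift ord0 i)).
  rewrite (tangent_proj_coord i ad cx prj ap v10.1).1.
  by rewrite (tangent_proj_coord i ad cx prj ap w10.1).1 pv pw.
apply: (tangent_ext ad.1 cx v10.1 w10.1) => j; last first.
  have hc := coord_holo j ad.1 cx.
  by rewrite (tangent10_conj v10 hc) (tangent10_conj w10 hc).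
case: (unliftP ord0 j) => [i ->//|->].
rewrite ((lift_coord0 ad cx v10).1 vn) ((lift_coord0 ad cx w10).1 wn).
by congr (_ * _); apply: eq_bigr => i _; rewrite vw.
Qed.

Lemma lift_exists X x : is_vfield10 X -> exists v, lift_at X x v.
Proof.
move=> X10; have [chi [phi [ad cx ap prj]]] := adapted_exists P x.
have hp := atlas_holo_chart ap; have [px _] := prj _ cx.
pose a i := X (pi x) (coord phi i).
(* The projection fixes the components [a]; the remaining one is forced by [lift_coord0]. *)
pose a0 := - (Hn x)^-1 * coord chi ord0 x *
  \sum_(i < n) a i * dz (lift ord0 i) (Hn \o bwd chi) (fwd chi x).
pose d j := if unlift ord0 j is Some i then a i else a0.
pose v := tvec chi d (fun=> 0) x.
have tv : tangent x v by apply: tangent_tvec => //; exact: ad.1.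
have vc j : v (coord chi j) = d j /\ v (cconj (coord chi j)) = 0.
  exact: tvec_coord ad.1 cx.
have vS i : v (coord chi (lift ord0 i)) = a i by rewrite (vc _).1 /d liftK.
have v0 : v (coord chi ord0) = a0 by rewrite (vc _).1 /d unlift_none.
have v10 : tangent10 x v.
  split=> //; apply: (J10_coord ad.1 cx tv) => j; exact: (vc j).2.
exists v; split=> //; last first.
  apply/(lift_coord0 ad cx v10); rewrite v0 /a0; congr (_ * _).
  by apply: eq_bigr => i _; rewrite vS.
apply: (tangent_ext hp px) => [||i|i].
- exact: (tangent_pushforward (proj_holo P x) tv).
- exact: X10.1.1.
- by rewrite -(tangent_proj_coord i ad cx prj ap tv).1 vS.
- rewrite -(tangent_proj_coord i ad cx prj ap tv).2 (vc _).2.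
  by rewrite (tangent10_conj (X10.2 _)) //; exact: coord_holo.
Qed.

Lemma lift_vfield X (Xt : vfield Mt) : is_vfield10 X ->
  (forall x, lift_at X x (Xt x)) -> is_vfield10 Xt.
Proof.
move=> X10 lX; split; last by move=> x; have [] := lX x.
apply: is_vfield_coord => x; first by have [[]] := lX x.
have [chi [phi [ad cx ap prj]]] := adapted_exists P x.
have hchi := ad.1; have hp := atlas_holo_chart ap; have [px _] := prj _ cx.
have XS z i : cdom chi z -> Xt z (coord chi (lift ord0 i)) = X (pi z) (coord phi i).
  move=> cz; have [z10 <- _] := lX z.
  by rewrite (tangent_proj_coord i ad cz prj ap z10.1).1.
have sX i : smooth_near (fun z => X (pi z) (coord phi i)) x.
  apply: (holo_map_smooth (proj_holo P x) (f := fun p => X p (coord phi i))).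
  by apply: (vfield_smooth X10.1); exact: coord_smooth.
exists chi; split=> // j; last first.
  apply: (smooth_near_eq (f := fun=> 0)); last exact: smooth_near_cst.
  apply: filterS (near_cdom cx) => z cz; have [z10 _ _] := lX z.
  by rewrite (tangent10_conj z10) //; exact: coord_holo.
case: (unliftP ord0 j) => [i ->|->].
  apply: smooth_near_eq (sX i).
  by apply: filterS (near_cdom cx) => z cz; rewrite XS.
apply: (smooth_near_eq (f := fun z => (-1 * (Hn z)^-1) * coord chi ord0 z *
    \sum_(i < n) X (pi z) (coord phi i) * dz (lift ord0 i) (Hn \o bwd chi) (fwd chi z))).
  apply: filterS (near_cdom cx) => z cz; have [z10 _ zn] := lX z.
  rewrite ((lift_coord0 ad cz z10).1 zn) mulN1r; congr (_ * _).
  by apply: eq_bigr => i _; rewrite XS.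
apply: smooth_nearM; first apply: smooth_nearM; first apply: smooth_nearM.
- exact: smooth_near_cst.
- by apply: smooth_nearV; [exact: Hnorm_smooth | exact: Hnorm_neq0].
- exact: coord_smooth.
- apply: smooth_near_sum => i; apply: smooth_nearM => //.
  apply: (smooth_near_comp (T := fwd chi) (g := dz (lift ord0 i) (Hn \o bwd chi))).
    by move=> k; exact: coord_smooth.
  by apply: csmooth_dz; apply/(smooth_nearP _ hchi cx); exact: Hnorm_smooth.
Qed.

(** One adapted chart around each point decides horizontality in all of them, since [lift_at]
    mentions none. *)
Lemma is_hliftP X (Xt : vfield Mt) : is_vfield10 X ->
  is_hlift P X Xt <-> forall x, lift_at X x (Xt x).
Proof.
move=> X10; split=> [[Xt10 pX oX] x|lX].
  split; [exact: Xt10.2|exact: pX|].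
  have [chi [phi [ad cx _ _]]] := adapted_exists P x.
  have /eqP := oX x chi ad cx; rewrite omegaE //; last exact: Xt10.2.
  by rewrite mulf_eq0 invr_eq0 (negbTE (Hnorm_neq0 P x)) => /eqP.
split; first exact: lift_vfield lX; first by move=> x; have [] := lX x.
by move=> x chi ad cx; have [x10 _ xn] := lX x; rewrite omegaE // xn mulr0.
Qed.

Lemma hlift_existsT X : is_vfield10 X -> exists! Xt : vfield Mt, is_hlift P X Xt.
Proof.
move=> X10; have [Xt lX] := boolp.choice (fun x => lift_exists x X10).
exists Xt; split; first exact/is_hliftP.
move=> Yt /(is_hliftP _ X10) lY; apply/funext => x; exact: lift_unique (lX x) (lY x).
Qed.

Lemma hliftP X : is_vfield10 X -> is_hlift P X (hlift P X).
Proof.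
move=> X10; have [Xt [hX _]] := hlift_existsT X10.
exact: (xgetPex _ (ex_intro _ Xt hX)).
Qed.

Lemma hlift_unique X Xt : is_vfield10 X -> is_hlift P X Xt -> hlift P X = Xt.
Proof.
move=> X10 hX; have [Yt [_ uY]] := hlift_existsT X10.
by rewrite -(uY _ (hliftP X10)) -(uY _ hX).
Qed.

Lemma hlift10 X : is_vfield10 X -> is_vfield10 (hlift P X).
Proof. by move=> /hliftP[]. Qed.

Lemma hlift_at X x : is_vfield10 X -> lift_at X x (hlift P X x).
Proof. by move=> X10; have /(is_hliftP _ X10) := hliftP X10. Qed.

Lemma smooth_proj (h : M -> C) : smooth h -> smooth (h \o pi).
Proof. by move=> sh x; apply: (holo_map_smooth (proj_holo P x)); exact: sh. Qed.

(** By uniqueness it suffices that the right-hand side is a lift, and the conditions of [lift_at]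
    are linear at each point. *)
Lemma hlift_flin (h : M -> C) X Y : smooth h -> is_vfield10 X -> is_vfield10 Y ->
  hlift P (flin h X Y) = flin (h \o pi) (hlift P X) (hlift P Y).
Proof.
move=> sh X10 Y10; have XY10 := vfield10_flin sh X10 Y10.
apply: hlift_unique => //; apply/(is_hliftP _ XY10) => x.
have [_ pX Xn] := hlift_at x X10; have [_ pY Yn] := hlift_at x Y10.
split.
- exact: (vfield10_flin (smooth_proj sh) (hlift10 X10) (hlift10 Y10)).2.
- rewrite /flin /= -pX -pY; apply/funext => f; rewrite /pushforward /vlin.
  by case: ifP => // _; rewrite mulr0 addr0.
- by rewrite /flin /vlin Xn Yn mulr0 addr0.
Qed.

Lemma hlift_Hb X x : is_vfield10 X -> kform P x (hlift P X x) (Hb x) = 0.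
Proof.
move=> X10; have X10' := hlift10 X10; rewrite kform_Hb; last exact: X10'.1.1.
have [_ _ Xn] := hlift_at x X10; have := vfield10_Hnorm P x X10'.
rewrite Xn => /esym/eqP; rewrite mulf_eq0 (negbTE (c_neq0 P)) => /eqP ->.
by rewrite mulr0.
Qed.

Lemma Hb_coord chi x j : adapted P chi -> cdom chi x -> Hb x (coord chi j) = 0.
Proof. by move=> ad cx; apply: fconj_coord => //; [exact: ad.1|exact: H_vfield10]. Qed.

Lemma H_cconj chi x j : adapted P chi -> cdom chi x -> Hf x (cconj (coord chi j)) = 0.
Proof.
move=> ad cx; rewrite (tangent10_conj ((H_vfield10 P).2 x)) //.
by apply: coord_holo => //; exact: ad.1.
Qed.

Lemma Hb_cconj chi x j : adapted P chi -> cdom chi x ->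
  Hb x (cconj (coord chi j)) = (if j == ord0 then c else 0) * cconj (coord chi j) x.
Proof.
move=> ad cx; rewrite /fconj /vconj cconjK H_coord // rmorphM /=.
by case: ifP => _; rewrite ?conj_real ?conjC0.
Qed.

(* Needed for [V] = H and for [V] = conj H; outside the vertical coordinate the
   bracket vanishes, and orthogonality to conj H kills the rest. *)
Lemma bracket_hlift_eq0 (V : vfield Mt) (k k' : C) (kb : 'I_n.+1 -> C) X :
  is_vfield V -> is_vfield10 X ->
  (forall chi x i, adapted P chi -> cdom chi x -> V x (coord chi (lift ord0 i)) = 0) ->
  (forall chi x j, adapted P chi -> cdom chi x ->
     V x (cconj (coord chi j)) = kb j * cconj (coord chi j) x) ->
  (forall i, kb (lift ord0 i) = 0) ->
  nab (hlift P X) V = fscale k (hlift P X) -> nab V Hb = fscale k' Hb ->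
  bracket V (hlift P X) = fun=> (fun=> 0).
Proof.
move=> vV X10 VS VJ kb0 XV VHb; apply/funext => x.
have Xt10 := hlift10 X10; set Xt := hlift P X in XV Xt10 *; have vX := Xt10.1.
have [chi [phi [ad cx ap prj]]] := adapted_exists P x.
have hchi := ad.1; have hp := atlas_holo_chart ap; have [px _] := prj _ cx.
have vB := vfield_bracket P vV vX; have tB := vB.1 x.
have scj j : smooth_near (cconj (coord chi j)) x.
  by apply: smooth_nearJ; exact: coord_smooth.
have BJ j : bracket V Xt x (cconj (coord chi j)) = 0.
  rewrite bracketE // (tangent_near0 (vV.1 x)); last first.
    apply: filterS (near_cdom cx) => z cz; rewrite (tangent10_conj (Xt10.2 z)) //.
    exact: coord_holo.
  rewrite (tangent_eq_near (g := fun z => kb j * cconj (coord chi j) z) (vX.1 x)); last first.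
    by apply: filterS (near_cdom cx) => z cz; exact: VJ.
  rewrite (tangentZ _ (vX.1 x)) // (tangent10_conj (Xt10.2 x)) ?mulr0 ?subrr //.
  exact: coord_holo.
have VP : pushforward pi x (V x) = fun=> 0.
  apply: (tangent_ext hp px) => [||i|i].
  - exact: (tangent_pushforward (proj_holo P x) (vV.1 x)).
  - exact: tangent0.
  - by rewrite -(tangent_proj_coord i ad cx prj ap (vV.1 x)).1 VS.
  - by rewrite -(tangent_proj_coord i ad cx prj ap (vV.1 x)).2 VJ // kb0 mul0r.
have BS i : bracket V Xt x (coord chi (lift ord0 i)) = 0.
  rewrite bracketE; last exact: coord_smooth.
  rewrite (tangent_near0 (vX.1 x)) ?subr0; last first.
    by apply: filterS (near_cdom cx) => z cz; exact: VS.
  (* The z-components of a lift are pulled back from the base, and [V] is vertical. *)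
  rewrite (tangent_eq_near (g := (fun p => X p (coord phi i)) \o pi) (vV.1 x)); last first.
    apply: filterS (near_cdom cx) => z cz; have [z10 pz _] := hlift_at z X10.
    by rewrite /Xt (tangent_proj_coord i ad cz prj ap z10.1).1 pz.
  have := congr1 (@^~ (fun p => X p (coord phi i))) VP.
  rewrite /pushforward asboolT //.
  by apply: (vfield_smooth X10.1); exact: coord_smooth.
have y0 := adapted_coord0_neq0 ad cx.
(* The bracket has only a y-component left; dividing by that of H gives its coefficient along H. *)
pose a := bracket V Xt x (coord chi ord0) / (c * coord chi ord0 x).
have BH : bracket V Xt x = vscale a (Hf x).
  apply: (tangent_ext hchi cx) => // [||j].
  - apply: tangent_vscale; exact: (vH P).1.
  - move=> j; case: (unliftP ord0 j) => [i ->|->].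
      by rewrite BS /vscale H_coord // [_ == _]eq_sym (negbTE (neq_lift _ _)) mul0r mulr0.
    by rewrite /vscale H_coord // eqxx /a mulfVK // mulf_neq0 // c_neq0.
  - by rewrite BJ /vscale H_cconj // mulr0.
(* Differentiating Phi(Xt, conj H) = 0 along [V] leaves a Phi(H, conj H) = 0, hence [a] = 0. *)
have XHb0 : Phi P Xt Hb = fun=> 0 by apply/funext => z; rewrite PhiE hlift_Hb.
have := nabla_Phi P vV vX (vHb P) x.
rewrite XHb0 (tangent_cst _ (vV.1 x)) VHb !PhiE.
have tX := vX.1 x; have tHb := (vHb P).1 x; have tH := (vH P).1 x.
rewrite [kform P x (Xt x) _]kform_scaler // hlift_Hb // mulr0 addr0.
rewrite (_ : nab V Xt x = vlin k (Xt x) (bracket V Xt x)); last first.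
  apply/funext => f; rewrite (nabla_swap P x f vV vX) XV.
  by [].
rewrite kform_linl // hlift_Hb // mulr0 add0r BH kform_scalel // kform_Hb //.
have nz : - 'i%C * Hn x != 0 by rewrite mulf_neq0 ?oppr_eq0 ?i_neq0 ?Hnorm_neq0.
rewrite -/(Hnorm P x) => /esym/eqP; rewrite mulf_eq0 (negbTE nz) orbF => /eqP ->.
by apply/funext => f; rewrite /vscale mul0r.
Qed.

Lemma bracket_H_hlift X : is_vfield10 X -> bracket Hf (hlift P X) = fun=> (fun=> 0).
Proof.
move=> X10; apply: (@bracket_hlift_eq0 _ c 0 (fun=> 0)) => //.
- exact: vH.
- move=> chi x i ad cx.
  by rewrite H_coord // [_ == _]eq_sym (negbTE (neq_lift _ _)) mul0r.
- by move=> chi x j ad cx; rewrite H_cconj // mul0r.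
- exact/nabla10_H/hlift10.
- rewrite nabla_Hb; last exact: H_vfield10.
  by apply/funext => x; apply/funext => f; rewrite /fscale /vscale mul0r.
Qed.

(** The zero is written as a multiple of the lift to match the hypotheses of [bracket_hlift_eq0] and
    [cubic_derivative]. *)
Lemma nabla_hlift_Hb X : is_vfield10 X -> nab (hlift P X) Hb = fscale 0 (hlift P X).
Proof.
move=> X10; rewrite nabla_Hb; last exact: hlift10.
by apply/funext => x; apply/funext => f; rewrite /fscale /vscale mul0r.
Qed.

Lemma bracket_Hb_hlift X : is_vfield10 X -> bracket Hb (hlift P X) = fun=> (fun=> 0).
Proof.
move=> X10.
apply: (@bracket_hlift_eq0 _ 0 c (fun j => if j == ord0 then c else 0)) => //.
- exact: vHb.
- by move=> chi x i ad cx; exact: Hb_coord.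
- by move=> chi x j ad cx; exact: Hb_cconj.
- exact: nabla_hlift_Hb.
- exact: nabla_Hb_Hb.
Qed.

Lemma descended_cubic_derivative X Y Z x :
  is_vfield10 X -> is_vfield10 Y -> is_vfield10 Z ->
  Hf x (descended_cubic P X Y Z) = 2%:R * c * descended_cubic P X Y Z x /\
  Hb x (descended_cubic P X Y Z) = 0.
Proof.
move=> X10 Y10 Z10.
have [hX hY hZ] : [/\ is_vfield10 (hlift P X), is_vfield10 (hlift P Y) & is_vfield10 (hlift P Z)].
  by split; exact: hlift10.
split.
  apply: cubic_derivative => //; [exact: vH|exact: nabla10_H|exact: nabla10_H|].
  by move=> W [->|[->|->]]; exact: bracket_H_hlift.
rewrite (@cubic_derivative _ _ _ _ 0 Hb) //; first by rewrite mulr0 mul0r.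
- exact: vHb.
- exact: nabla_hlift_Hb.
- exact: nabla_hlift_Hb.
- by move=> W [->|[->|->]]; exact: bracket_Hb_hlift.
Qed.

End Lift.

(** * Homogeneity *)

Section Homogeneity.
Variables (R : realType) (n : nat) (Mt : cmanifold R n.+1) (M : cmanifold R n).
Variable P : projective_special_kahler Mt M.
Local Notation C := R[i].
Local Notation act := (act P).
Local Notation Hf := (H P).
Local Notation Hb := (fconj (H P)).
Local Notation c := (((cst P)%:C)%C : C).
Implicit Types (x z : Mt) (b : C) (chi : chart R Mt n.+1) (f : Mt -> C).

(** In the chart, H is c y d/dy and conj H is c conj y d/d(conj y), with coefficients that never
    vanish. *)
Lemma dz0_eq0 chi x f : adapted P chi -> cdom chi x -> smooth_near f x ->
  Hf x f = 0 -> Hb x f = 0 ->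
  dz ord0 (f \o bwd chi) (fwd chi x) = 0 /\ dzb ord0 (f \o bwd chi) (fwd chi x) = 0.
Proof.
move=> ad cx sf; rewrite (tangentE ad.1 cx ((vH P).1 x)) (tangentE ad.1 cx ((vHb P).1 x)).
rewrite !(tvecE _ _ _ sf) /wirt !big_ord_recl.
have y0 := adapted_coord0_neq0 ad cx; have c0 := c_neq0 P.
rewrite big1 => [|i _]; last first.
  by rewrite H_coord // H_cconj // [_ == _]eq_sym (negbTE (neq_lift _ _)) !mul0r addr0.
rewrite big1 => [|i _]; last first.
  by rewrite Hb_coord // Hb_cconj // [_ == _]eq_sym (negbTE (neq_lift _ _)) !mul0r addr0.
rewrite H_coord // H_cconj // Hb_coord // Hb_cconj // eqxx !mul0r !addr0 add0r.
have cy0 : c * coord chi ord0 x != 0 by rewrite mulf_neq0.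
have cyb0 : c * cconj (coord chi ord0) x != 0 by rewrite mulf_neq0 // /cconj conjC_eq0.
move=> /eqP; rewrite mulf_eq0 (negbTE cy0) => /eqP -> /eqP.
by rewrite mulf_eq0 (negbTE cyb0) => /eqP ->.
Qed.

(** The action is linear in y and leaves the z^i alone, so the segment from 1 to b acts along a
    straight segment of the chart. *)
Lemma act_segment chi x b (t : R) : adapted P chi -> cdom chi x ->
  1 + (t%:C)%C * (b - 1) != 0 ->
  fwd chi (act (1 + (t%:C)%C * (b - 1)) x) =
  fwd chi x + t *: cpack (fun j => if j == ord0 then (b - 1) * coord chi ord0 x else 0).
Proof.
move=> [hchi ad] cx b0; have [_ e0 eS] := ad _ x b0 cx.
apply: cspace_ext => j; rewrite [in RHS]addrC zc_lin zc_cpack.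
case: (unliftP ord0 j) => [i ->|->].
  by rewrite [_ == _]eq_sym (negbTE (neq_lift _ _)) mulr0 add0r; exact: eS.
rewrite eqxx -[zc _ _]/(coord chi ord0 (act (1 + (t%:C)%C * (b - 1)) x)) e0.
by rewrite -[zc _ _]/(coord chi ord0 x) mulrDl mul1r addrC mulrA.
Qed.

Lemma homogeneous_segment k f x b : smooth f ->
  (forall z, Hf z f = k%:R * c * f z) -> (forall z, Hb z f = 0) ->
  complex.Im b != 0 \/ 0 < complex.Re b -> f (act b x) = b ^+ k * f x.
Proof.
move=> sf Hff Hbf hb; have [chi [_ [ad cx _ _]]] := adapted_exists P x.
pose Y z := (coord chi ord0 z)^-1; pose g z := f z * Y z ^+ k.
have hchi := ad.1.
have y0 z : cdom chi z -> coord chi ord0 z != 0 := adapted_coord0_neq0 ad.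
have sY z : cdom chi z -> smooth_near Y z.
  by move=> cz; apply: smooth_nearV; [exact: coord_smooth | exact: y0].
have YS l : (fun z => Y z ^+ l.+1) = fun z => Y z * Y z ^+ l.
  by apply/funext => z; rewrite exprS.
have sYk z l : cdom chi z -> smooth_near (fun z => Y z ^+ l) z.
  move=> cz; elim: l => [|l IH]; first exact: smooth_near_cst.
  rewrite YS.
  by apply: smooth_nearM => //; exact: sY.
have sg z : cdom chi z -> smooth_near g z.
  by move=> cz; apply: smooth_nearM; [exact: sf | exact: sYk].
(* Applied to H with a = c and to conj H with a = 0. *)
have DY z (v : vec Mt) (a : C) : cdom chi z -> tangent z v ->
    v (coord chi ord0) = a * coord chi ord0 z ->
    forall l, v (fun z => Y z ^+ l) = - (l%:R * a) * Y z ^+ l.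
  move=> cz tv va; have vY : v Y = - a * Y z.
    rewrite (tangentV tv) ?va; [|exact: coord_smooth|exact: y0].
    by rewrite /Y; have := y0 z cz; move: (coord _ _ _) => u u0; field.
  elim=> [|l IH]; first by rewrite (tangent_cst _ tv) mul0r oppr0 mul0r.
  rewrite YS.
  rewrite (tangentM tv) ?IH ?vY; [|exact: sY|exact: sYk].
  by rewrite exprS -[in RHS]natr1; move: (Y z) (Y z ^+ l) => u w; ring.
have Hg z : cdom chi z -> Hf z g = 0.
  move=> cz; rewrite (tangentM ((vH P).1 z)); [|exact: sf|exact: sYk].
  rewrite (DY z _ c cz ((vH P).1 z)); last by rewrite H_coord // eqxx.
  by rewrite Hff; move: (f z) (Y z ^+ k) => u w; ring.
have Hbg z : cdom chi z -> Hb z g = 0.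
  move=> cz; rewrite (tangentM ((vHb P).1 z)); [|exact: sf|exact: sYk].
  rewrite (DY z _ 0 cz ((vHb P).1 z)); last by rewrite Hb_coord // mul0r.
  by rewrite Hbf !mulr0 oppr0 mul0r mulr0 addr0.
pose v := cpack (fun j : 'I_n.+1 => if j == ord0 then (b - 1) * coord chi ord0 x else 0).
have seg (t : R) : 0 <= t <= 1 -> exists2 z, cdom chi z & fwd chi x + t *: v = fwd chi z.
  move=> t01; have bt0 := segment_neq0 hb t01.
  exists (act (1 + (t%:C)%C * (b - 1)) x); last by rewrite act_segment.
  by have [] := ad.2 _ x bt0 cx.
have b0 : b != 0.
  have := segment_neq0 hb (_ : 0 <= 1 <= 1); rewrite mul1r addrC subrK; apply.
  by rewrite ler01 lexx.
have gE : (g \o bwd chi) (fwd chi x + v) = (g \o bwd chi) (fwd chi x).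
  (* The direction has a y-component only, and both y-derivatives of [g] vanish at every point of
     the segment. *)
  apply: dder0_segment => t /seg[z cz ->].
  have cg := csmooth_cdiff ((smooth_nearP _ hchi cz).1 (sg z cz)).
  split=> //; rewrite dder_wirtinger // big_ord_recl.
  have [-> ->] := dz0_eq0 ad cz (sg z cz) (Hg z cz) (Hbg z cz).
  rewrite !mulr0 add0r add0r big1 // => i _.
  by rewrite zc_cpack [_ == _]eq_sym (negbTE (neq_lift _ _)) conjC0 !mul0r addr0.
have [cbx e0 _] := ad.2 _ x b0 cx.
have vE : fwd chi x + v = fwd chi (act b x).
  have := @act_segment chi x b 1 ad cx; rewrite mul1r addrC subrK scale1r => -> //.
move: gE; rewrite vE /= !fwdK // /g /Y e0 invfM exprMn !exprVn => h.
have yk0 : coord chi ord0 x ^- k != 0 by rewrite invr_neq0 // expf_neq0 // y0.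
have bk0 : b ^+ k != 0 by rewrite expf_neq0.
by apply: (mulIf yk0); rewrite -[in RHS]mulrA -h mulrCA mulVKf.
Qed.

Lemma homogeneous_of_derivative k f b x : smooth f ->
  (forall z, Hf z f = k%:R * c * f z) -> (forall z, Hb z f = 0) ->
  b != 0 -> f (act b x) = b ^+ k * f x.
Proof.
move=> sf Hff Hbf b0; have hseg := homogeneous_segment _ sf Hff Hbf.
have [Imb|Imb] := eqVneq (complex.Im b) 0; last by apply: hseg; left.
have [Reb|Reb] := ltP 0 (complex.Re b); first by apply: hseg; right.
(* a negative real number is the product of two non-real numbers *)
have bE : b = 'i%C * (- 'i%C * b) by rewrite mulrA mulrN sqi opprK mul1r.
have ib0 : - 'i%C * b != 0 by rewrite mulf_neq0 ?oppr_eq0 ?i_neq0.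
rewrite {1}bE act_M ?i_neq0 // !hseg.
- by rewrite mulrA -exprMn -bE.
- left; rewrite Im_mul Re_opp Im_opp /= oppr0 mul0r add0r mulN1r oppr_eq0.
  by apply: contraNneq b0 => Reb0; rewrite eq_complex /= Imb Reb0 eqxx.
- by left; rewrite /= oner_eq0.
Qed.

End Homogeneity.

(** [hlift] is a choice with default 0; the first conjunct certifies that [descended_cubic] is
    evaluated on the genuine horizontal lifts. *)
Theorem mainTheorem4 (R : realType) (n : nat)
    (Mt : cmanifold R n.+1) (M : cmanifold R n)
    (P : projective_special_kahler Mt M) :
  (forall X : vfield M, is_vfield10 X ->
     exists! Xt : vfield Mt, is_hlift P X Xt) /\
  section_Lstar_T3 P 2 (descended_cubic P).
Proof.
split=> [X|]; first exact: hlift_existsT.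
have tl (X : vfield M) x : is_vfield10 X -> tangent x (hlift P X x).
  by move=> X10; exact: (hlift10 P X10).1.1.
have tn (X Y : vfield M) x : is_vfield10 X -> is_vfield10 Y ->
    tangent x (nabla P (hlift P X) (hlift P Y) x).
  by move=> X10 Y10; apply: (nabla_vfield P (hlift10 P X10).1 (hlift10 P Y10).1).1.
split=> [X Y Z X10 Y10 Z10|h X X' Y Z sh X10 X10' Y10 Z10 x
  |h X Y Y' Z sh X10 Y10 Y10' Z10 x|h X Y Z Z' sh X10 Y10 Z10 Z10' x].
- have D z := descended_cubic_derivative P z X10 Y10 Z10.
  have sd : smooth (descended_cubic P X Y Z) by apply: cubic_smooth; exact: hlift10.
  split=> // b x; apply: homogeneous_of_derivative => // z; exact: (D z).1 || exact: (D z).2.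
- rewrite /descended_cubic !cubic_kform; try exact: hlift10.
    by rewrite hlift_flin // /flin kform_linl //; (exact: tl || exact: tn).
  exact/hlift10/vfield10_flin.
- rewrite /descended_cubic !cubic_kform; try exact: hlift10.
    rewrite hlift_flin // nabla_linl; try exact: (hlift10 P _).1.
      by rewrite /flin kform_linr //; (exact: tl || exact: tn).
    exact: smooth_proj.
  exact/hlift10/vfield10_flin.
- rewrite /descended_cubic !cubic_kform; try exact: hlift10; last exact/hlift10/vfield10_flin.
  have hh := smooth_proj P sh.
  rewrite hlift_flin // nabla_leibniz; try exact: (hlift10 P _).1; last by [].
  have tZ := tl Z x Z10; have tN := tn Y Z x Y10 Z10; have tN' := tn Y Z' x Y10 Z10'.
  rewrite /flin kform_linr //; [|exact: tangent_vlin|exact: tl].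
  rewrite kform_linr //; last exact: tl.
  rewrite kform10 ?mulr0 ?add0r //; first exact: tl.
    exact: ((hlift10 P X10).2 x).2.
  exact: ((hlift10 P Z10).2 x).2.
Qed.
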